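(* There exists a transcendental entire function $g$ such that the antiholomorphic flow $\dot z = \overline{g(z)}$ has no trajectories tending to infinity in finite increasing time.
   Context: A trajectory of the flow $\dot z = \overline{g(z)}$ is a path $z(t)$ with $z'(t) = \overline{g(z(t))}$ for $t$ in a maximal interval $(\alpha,\beta)\subseteq\mathbb{R}$. It tends to infinity in finite increasing time if $\beta<+\infty$ and $z(t) \to \infty$ as $t \to \beta^-$. *)

(* Defs.v *)
From Stdlib Require Import Reals.
From Coquelicot Require Import Coquelicot.
Open Scope R_scope.

Definition entire (g : C -> C) : Prop :=
  forall z : C, @ex_derive C_AbsRing C_NormedModule g z.

Definition is_polynomial_fun (g : C -> C) : Prop :=
  exists (n : nat) (a : nat -> C),
    forall z : C, g z = sum_n (fun k => Cmult (a k) (pow_n z k)) n.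

Definition transcendental_entire (g : C -> C) : Prop :=
  entire g /\ ~ is_polynomial_fun g.

Definition solves_on (g : C -> C) (a b : Rbar) (z : R -> C) : Prop :=
  Rbar_lt a b /\
  forall t : R, Rbar_lt a (Finite t) -> Rbar_lt (Finite t) b ->
    @is_derive R_AbsRing C_R_NormedModule z t (Cconj (g (z t))).

Definition trajectory (g : C -> C) (a b : Rbar) (z : R -> C) : Prop :=
  solves_on g a b z /\
  forall (a' b' : Rbar) (z' : R -> C),
    solves_on g a' b' z' -> Rbar_le a' a -> Rbar_le b b' ->
    (forall t : R, Rbar_lt a (Finite t) -> Rbar_lt (Finite t) b -> z' t = z t) ->
    a' = a /\ b' = b.

Definition escapes_in_finite_time (a b : Rbar) (z : R -> C) : Prop :=
  exists beta : R, b = Finite beta /\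
    filterlim (fun t => Cmod (z t)) (at_left beta) (Rbar_locally p_infty).

(* Main.v *)
Require Import Defs.
From Stdlib Require Import Reals Lra Lia ClassicalEpsilon.
From Coquelicot Require Import Coquelicot.

(* Along a trajectory of z' = conj (G'(z)) the imaginary part of G is constant and Re G
   increases at the rate |G'(z)|^2.  We take G to be the limit of polynomials
   f_0 = id, f_(k+1) = P_k o f_k, with P_k(w) = (q/M) (1 - (1 - w/q)^M) for some q, M
   depending on k, so that all critical values of G are real.  A trajectory escaping to
   infinity on which Im G = c must, for all large k, cross the level Re G = q/M, and then it
   is within bounded distance of the critical value q/M in the f_(k+1)-plane.
   If the multiplicity M exceeds the degree n of f_k and q is huge, the last bounded piece of this passage has a large
   length L in the f_k-plane compared with the size q^(1-1/n) of f_k' there, whereas the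
   time T it takes satisfies L <= O(q^(1-1/n)) (T + O(1)); hence T is as large as we please.
   M is a power of 2 so that the surjectivity of P_k only requires complex square roots;
   g = G' has arbitrarily large zeros, the solutions of f_k = q, hence is transcendental. *)

(** * Complex derivatives and the mean value inequality *)

Definition cderiv (f : C -> C) (x d : C) : Prop :=
  @is_derive C_AbsRing C_NormedModule f x d.

Definition pderiv (z : R -> C) (t : R) (d : C) : Prop :=
  @is_derive R_AbsRing C_R_NormedModule z t d.

Lemma cderiv_iff (f : C -> C) (x d : C) :
  cderiv f x d <->
  forall eps : R, 0 < eps -> exists delta : R, 0 < delta /\
    forall y : C, Cmod (y - x) < delta ->
      Cmod (f y - f x - (y - x) * d) <= eps * Cmod (y - x).
Proof.
split.
- intros [_ H] eps Heps.
  destruct (H x (fun P HP => HP) (mkposreal eps Heps)) as [delta Hd].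
  exists delta; split; [apply cond_pos|].
  intros y Hy. exact (Hd y Hy).
- intros H; split; [apply is_linear_scal_l|].
  intros x' Hx' eps.
  (* [is_derive] quantifies over every limit [x'] of the neighbourhood filter of [x]; uniqueness of
     limits gives [x' = x]. *)
  apply (@is_filter_lim_locally_unique C_AbsRing (AbsRing_NormedModule C_AbsRing)) in Hx'.
  subst x'.
  destruct (H eps (cond_pos eps)) as [delta [Hd1 Hd2]].
  exists (mkposreal delta Hd1). intros y Hy. exact (Hd2 y Hy).
Qed.

Lemma pderiv_iff (z : R -> C) (t : R) (d : C) :
  pderiv z t d <->
  forall eps : R, 0 < eps -> exists delta : R, 0 < delta /\
    forall s : R, Rabs (s - t) < delta ->
      Cmod (z s - z t - RtoC (s - t) * d) <= eps * Rabs (s - t).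
Proof.
assert (E : forall s : R, @norm R_AbsRing C_R_NormedModule
   (minus (minus (z s) (z t)) (scal (minus s t) d))
   = Cmod (z s - z t - RtoC (s - t) * d)).
{ intros s. rewrite Cmod_norm. f_equal.
  destruct (z s), (z t), d.
  unfold minus, plus, opp, scal, Cminus, Cplus, Copp, Cmult, RtoC; simpl.
  unfold minus, plus, opp, prod_scal, scal; simpl. unfold mult; simpl.
  apply injective_projections; simpl; ring. }
split.
- intros [_ H] eps Heps.
  destruct (H t (fun P HP => HP) (mkposreal eps Heps)) as [delta Hd].
  exists delta; split; [apply cond_pos|].
  intros s Hs. rewrite <- E. exact (Hd s Hs).
- intros H; split; [apply is_linear_scal_l|].
  intros x' Hx' eps.
  apply (@is_filter_lim_locally_unique R_AbsRing R_NormedModule) in Hx'.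
  subst x'.
  destruct (H eps (cond_pos eps)) as [delta [Hd1 Hd2]].
  exists (mkposreal delta Hd1). intros s Hs. exact (Rle_trans _ _ _ (Req_le _ _ (E s)) (Hd2 s Hs)).
Qed.

(** The remainder of the composite is the remainder of [f] at [z t] plus [d] times the remainder of
    [z]; each part is kept below half of [eps]. *)
Lemma pderiv_comp (f : C -> C) (z : R -> C) (t : R) (d e : C) :
  cderiv f (z t) d -> pderiv z t e -> pderiv (fun s => f (z s)) t (d * e)%C.
Proof.
intros Hf Hz. rewrite cderiv_iff in Hf. rewrite pderiv_iff in Hz.
apply pderiv_iff. intros eps Heps.
pose proof (Cmod_ge_0 d) as Pd. pose proof (Cmod_ge_0 e) as Pe.
set (K := Cmod e + 1).
destruct (Hf (eps / (2 * K))) as [d1 [Hd1 F]].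
{ apply Rdiv_lt_0_compat; unfold K; lra. }
(* The bound [1] yields the Lipschitz constant [K] of [z] near [t]; the other bound compensates the
   factor [d]. *)
destruct (Hz (Rmin 1 (eps / (2 * (Cmod d + 1))))) as [d2 [Hd2 Z]].
{ apply Rmin_glb_lt; [lra|]. apply Rdiv_lt_0_compat; lra. }
exists (Rmin d2 (d1 / K)); split.
{ apply Rmin_glb_lt; [lra|]. apply Rdiv_lt_0_compat; unfold K; lra. }
intros s Hs.
assert (Hs2 : Rabs (s - t) < d2) by (eapply Rlt_le_trans; [exact Hs|apply Rmin_l]).
assert (Hs1 : Rabs (s - t) < d1 / K) by (eapply Rlt_le_trans; [exact Hs|apply Rmin_r]).
specialize (Z s Hs2).
pose proof (Rabs_pos (s - t)) as Ps.
assert (Zl : Cmod (z s - z t) <= K * Rabs (s - t)).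
{ replace (z s - z t)%C with ((z s - z t - RtoC (s - t) * e) + RtoC (s - t) * e)%C by ring.
  eapply Rle_trans; [apply Cmod_triangle|].
  rewrite Cmod_mult, Cmod_R.
  assert (Rmin 1 (eps / (2 * (Cmod d + 1))) * Rabs (s - t) <= 1 * Rabs (s - t)).
  { apply Rmult_le_compat_r; [lra|apply Rmin_l]. }
  unfold K; lra. }
assert (HK : 0 < K) by (unfold K; lra).
assert (Hd : Cmod (z s - z t) < d1).
{ eapply Rle_lt_trans; [exact Zl|]. apply Rmult_lt_compat_l with (r := K) in Hs1; [|lra].
  replace (K * (d1 / K)) with d1 in Hs1 by (field; lra). lra. }
specialize (F (z s) Hd).
replace (f (z s) - f (z t) - RtoC (s - t) * (d * e))%C with
  ((f (z s) - f (z t) - (z s - z t) * d) + d * (z s - z t - RtoC (s - t) * e))%C by ring.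
eapply Rle_trans; [apply Cmod_triangle|]. rewrite Cmod_mult.
assert (eps / (2 * K) * Cmod (z s - z t) <= eps / 2 * Rabs (s - t)).
{ replace (eps / 2 * Rabs (s - t)) with (eps / (2 * K) * (K * Rabs (s - t))) by (field; lra).
  apply Rmult_le_compat_l; [|lra]. apply Rlt_le, Rdiv_lt_0_compat; lra. }
assert (Cmod d * Cmod (z s - z t - RtoC (s - t) * e) <= eps / 2 * Rabs (s - t)).
{ apply Rle_trans with ((Cmod d + 1) * (eps / (2 * (Cmod d + 1)) * Rabs (s - t))).
  - apply Rmult_le_compat; try lra; [apply Cmod_ge_0|].
    eapply Rle_trans; [exact Z|]. apply Rmult_le_compat_r; [lra|apply Rmin_r].
  - right; field; lra. }
lra.
Qed.

(** The weight [w] covers all real-linear functionals at once; below it is [1], [Ci], [- Ci] or the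
    conjugate of an increment. *)
Lemma pderiv_Re (z : R -> C) (t : R) (d w : C) :
  pderiv z t d -> is_derive (fun s => Re (w * z s)) t (Re (w * d)).
Proof.
intros Hz. rewrite pderiv_iff in Hz.
apply is_derive_Reals. intros eps Heps.
pose proof (Cmod_ge_0 w) as Pw.
destruct (Hz (eps / (2 * (Cmod w + 1)))) as [delta [Hd Z]].
{ apply Rdiv_lt_0_compat; lra. }
exists (mkposreal delta Hd). intros h Hh Hhd. simpl in Hhd.
specialize (Z (t + h)). replace (t + h - t) with h in Z by ring.
specialize (Z Hhd).
replace ((Re (w * z (t + h)%R) - Re (w * z t)) / h - Re (w * d)) with
  (Re (w * (z (t + h)%R - z t - RtoC h * d)) / h).
2:{ destruct w, (z t), (z (t + h)), d; unfold Re, Cmult, Cminus, Cplus, Copp, RtoC; simpl. field; auto. }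
unfold Rdiv. rewrite Rabs_mult, Rabs_inv.
pose proof (Rabs_pos_lt h Hh) as Ph.
apply Rle_lt_trans with (Cmod w * (eps / (2 * (Cmod w + 1)) * Rabs h) * / Rabs h).
- apply Rmult_le_compat_r; [apply Rlt_le, Rinv_0_lt_compat; lra|].
  eapply Rle_trans; [apply re_le_Cmod|]. rewrite Cmod_mult.
  apply Rmult_le_compat_l; lra.
- apply Rle_lt_trans with (eps / 2 * (Cmod w / (Cmod w + 1))); [right; field; lra|].
  assert (Cmod w / (Cmod w + 1) <= 1).
  { apply Rmult_le_reg_r with (Cmod w + 1); [lra|]. unfold Rdiv.
    rewrite Rmult_assoc, Rinv_l; lra. }
  assert (0 <= Cmod w / (Cmod w + 1)).
  { apply Rmult_le_pos; [lra|]. apply Rlt_le, Rinv_0_lt_compat; lra. }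
  nra.
Qed.

Lemma pderiv_affine_path (x v : C) (t : R) :
  pderiv (fun s => x + RtoC s * v)%C t v.
Proof.
apply pderiv_iff. intros eps Heps. exists 1; split; [lra|]. intros s _.
replace (x + RtoC s * v - (x + RtoC t * v) - RtoC (s - t) * v)%C with (RtoC 0).
- rewrite Cmod_0. pose proof (Rabs_pos (s - t)). nra.
- rewrite RtoC_minus. ring.
Qed.

Lemma is_derive_nonneg_le (h dh : R -> R) (a b : R) :
  a <= b -> (forall t, a <= t <= b -> is_derive h t (dh t)) ->
  (forall t, a <= t <= b -> 0 <= dh t) -> h a <= h b.
Proof.
intros Hab Hd Hp.
destruct (MVT_gen h a b dh) as [c [Hc E]].
- intros x Hx. rewrite Rmin_left, Rmax_right in Hx by lra. apply Hd; lra.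
- intros x Hx. rewrite Rmin_left, Rmax_right in Hx by lra.
  apply continuity_pt_filterlim.
  apply (@ex_derive_continuous R_AbsRing R_NormedModule). exists (dh x). apply Hd; lra.
- rewrite Rmin_left, Rmax_right in Hc by lra.
  specialize (Hp c Hc). nra.
Qed.

(* Projecting on the direction of [psi b - psi a] reduces this to the real mean value theorem. *)
Lemma mean_value_ineq (psi : R -> C) (dpsi : R -> C) (phi dphi : R -> R) (a b : R) :
  a <= b ->
  (forall t, a <= t <= b -> pderiv psi t (dpsi t)) ->
  (forall t, a <= t <= b -> is_derive phi t (dphi t)) ->
  (forall t, a <= t <= b -> Cmod (dpsi t) <= dphi t) ->
  Cmod (psi b - psi a) <= phi b - phi a.
Proof.
intros Hab Hpsi Hphi Hle.
set (D := (psi b - psi a)%C).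
destruct (Req_dec (Cmod D) 0) as [E0|E0].
{ rewrite E0.
  cut (phi a <= phi b); [lra|].
  apply (is_derive_nonneg_le phi dphi a b Hab Hphi).
  intros t Ht. pose proof (Cmod_ge_0 (dpsi t)). specialize (Hle t Ht). lra. }
pose proof (Cmod_ge_0 D) as PD.
set (w := (Cconj D)%C).
assert (H : Cmod D * phi a - Re (w * psi a) <= Cmod D * phi b - Re (w * psi b)).
{ apply (is_derive_nonneg_le (fun t => Cmod D * phi t - Re (w * psi t))
     (fun t => Cmod D * dphi t - Re (w * dpsi t)) a b Hab).
  - intros t Ht. apply (is_derive_minus (V := R_NormedModule)).
    + apply is_derive_scal. auto.
    + apply pderiv_Re. auto.
  - intros t Ht. specialize (Hle t Ht).
    pose proof (re_le_Cmod (w * dpsi t)) as Q. rewrite Cmod_mult in Q.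
    unfold w in Q at 2. rewrite Cmod_conj in Q.
    pose proof (Rle_abs (Re (w * dpsi t))). nra. }
assert (E : Re (w * psi b) - Re (w * psi a) = Cmod D ^ 2).
{ replace (Re (w * psi b) - Re (w * psi a)) with (Re (w * D)).
  - rewrite Cmod2_alt. unfold w. destruct D; unfold Re, Im, Cconj, Cmult; simpl; ring.
  - unfold D. destruct w, (psi a), (psi b); unfold Re, Cmult, Cminus, Cplus, Copp; simpl; ring. }
nra.
Qed.

Lemma cmean_value_ineq (f d : C -> C) (x y : C) (K : R) :
  (forall z, cderiv f z (d z)) ->
  (forall t, 0 <= t <= 1 -> Cmod (d (x + RtoC t * (y - x))%C) <= K) ->
  Cmod (f y - f x) <= K * Cmod (y - x).
Proof.
intros Hf Hd.
pose proof (mean_value_ineq (fun t => f (x + RtoC t * (y - x))%C)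
  (fun t => d (x + RtoC t * (y - x))%C * (y - x))%C
  (fun t => t * (K * Cmod (y - x))) (fun t => K * Cmod (y - x)) 0 1) as H.
simpl in H.
replace (x + RtoC 1 * (y - x))%C with y in H by ring.
replace (x + RtoC 0 * (y - x))%C with x in H by ring.
replace (1 * (K * Cmod (y - x)) - 0 * (K * Cmod (y - x))) with (K * Cmod (y - x)) in H by ring.
apply H.
- lra.
- intros t _. apply (pderiv_comp f); [apply Hf|apply pderiv_affine_path].
- intros t _. auto_derive; [trivial|ring].
- intros t Ht. rewrite Cmod_mult. apply Rmult_le_compat_r; [apply Cmod_ge_0|auto].
Qed.

(** * Limits of rapidly converging sequences of functions *)

(** The discs grow with [k], so on a bounded set the estimate holds from some index on, and the tail
    from [k] sums to at most [(1/2) ^ k]. *)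
Definition fast_cauchy (phi : nat -> C -> C) : Prop :=
  forall (k : nat) (z : C), Cmod z <= INR k ->
    Cmod (phi (S k) z - phi k z) <= (1/2) ^ (S k).

Definition fast_limit (phi : nat -> C -> C) (l : C -> C) : Prop :=
  forall (k : nat) (z : C), Cmod z <= INR k -> Cmod (l z - phi k z) <= (1/2) ^ k.

Lemma half_pow_pos (k : nat) : 0 < (1/2) ^ k.
Proof. apply pow_lt; lra. Qed.

Lemma half_pow_le_1 (k : nat) : (1/2) ^ k <= 1.
Proof. induction k; simpl; [lra|]. pose proof (half_pow_pos k). lra. Qed.

Lemma half_pow_small (eps : R) : 0 < eps -> exists N, forall n, (N <= n)%nat -> (1/2) ^ n < eps.
Proof.
intros He. destruct (pow_lt_1_zero (1/2)) with (y := eps) as [N HN]; [rewrite Rabs_pos_eq; lra|lra|].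
exists N. intros n Hn. specialize (HN n Hn).
rewrite Rabs_pos_eq in HN; [lra|]. left; apply half_pow_pos.
Qed.

Lemma telescope_half (u : nat -> C) (k : nat) :
  (forall j, (k <= j)%nat -> Cmod (u (S j) - u j) <= (1/2) ^ (S j)) ->
  forall i, Cmod (u (k + i)%nat - u k) <= (1/2) ^ k - (1/2) ^ (k + i).
Proof.
intros H. induction i.
- rewrite Nat.add_0_r. replace (u k - u k)%C with (RtoC 0) by ring. rewrite Cmod_0. lra.
- rewrite Nat.add_succ_r.
  replace (u (S (k + i)) - u k)%C with ((u (S (k + i)) - u (k + i)%nat) + (u (k + i)%nat - u k))%C by ring.
  eapply Rle_trans; [apply Cmod_triangle|].
  specialize (H (k + i)%nat ltac:(lia)). simpl in *. lra.
Qed.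

Lemma half_cauchy_limit (u : nat -> C) (k : nat) :
  (forall j, (k <= j)%nat -> Cmod (u (S j) - u j) <= (1/2) ^ (S j)) ->
  exists l : C, forall j, (k <= j)%nat -> Cmod (l - u j) <= (1/2) ^ j.
Proof.
intros H.
assert (Hc : forall j i, (k <= j)%nat -> Cmod (u (j + i)%nat - u j) <= (1/2) ^ j).
{ intros j i Hj. eapply Rle_trans; [apply telescope_half; intros; apply H; lia|].
  pose proof (half_pow_pos (j + i)). lra. }
assert (Hproj : forall p : C -> R, (forall x y, Rabs (p x - p y) <= Cmod (x - y)) ->
  exists l : R, is_lim_seq (fun n => p (u n)) l).
{ intros p Hp.
  destruct (proj2 (ex_lim_seq_cauchy_corr (fun n => p (u n)))) as [l Hl].
  - intros eps. destruct (half_pow_small (eps / 2)) as [N HN]; [destruct eps; simpl; lra|].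
    exists (max N k). intros n m Hn Hm.
    assert (Q : forall n, (max N k <= n)%nat -> Rabs (p (u n) - p (u (max N k))) < eps / 2).
    { intros i Hi. eapply Rle_lt_trans; [apply Hp|].
      replace i with (max N k + (i - max N k))%nat by lia.
      eapply Rle_lt_trans; [apply Hc; lia|]. apply HN; lia. }
    pose proof (Q n Hn) as Q1. pose proof (Q m Hm) as Q2.
    apply Rabs_def2 in Q1. apply Rabs_def2 in Q2. apply Rabs_def1; lra.
  - exists l. exact Hl. }
destruct (Hproj Re) as [a Ha].
{ intros x y. replace (Re x - Re y) with (Re (x - y)) by (destruct x, y; reflexivity).
  apply re_le_Cmod. }
destruct (Hproj Im) as [b Hb].
{ intros x y. replace (Im x - Im y) with (Im (x - y)) by (destruct x, y; reflexivity).
  eapply Rle_trans; [apply Rmax_r|apply Rmax_Cmod]. }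
exists (a, b). intros j Hj.
apply Rnot_lt_le. intros Hlt.
(* A quarter of the supposed excess: for large [n] both coordinates are within [eps], so the modulus
   is below [2 * eps], which contradicts an excess of [4 * eps]. *)
set (eps := (Cmod ((a, b) - u j) - (1/2) ^ j) / 4).
assert (He : 0 < eps) by (unfold eps; lra).
apply is_lim_seq_spec in Ha. apply is_lim_seq_spec in Hb.
destruct (Ha (mkposreal eps He)) as [N1 H1]. destruct (Hb (mkposreal eps He)) as [N2 H2].
set (n := (j + (N1 + N2))%nat).
specialize (H1 n ltac:(unfold n; lia)). specialize (H2 n ltac:(unfold n; lia)). simpl in H1, H2.
assert (Cmod ((a, b) - u n) < 2 * eps).
{ eapply Rle_lt_trans; [apply Cmod_2Rmax|].
  assert (Rmax (Rabs (fst ((a, b) - u n)%C)) (Rabs (snd ((a, b) - u n)%C)) < eps).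
  { apply Rmax_lub_lt; rewrite <- Rabs_Ropp.
    - replace (- fst ((a, b) - u n)%C) with (Re (u n) - a); [assumption|].
      destruct (u n); unfold Re; simpl; ring.
    - replace (- snd ((a, b) - u n)%C) with (Im (u n) - b); [assumption|].
      destruct (u n); unfold Im; simpl; ring. }
  pose proof (Rabs_pos (fst ((a, b) - u n)%C)).
  pose proof (Rmax_l (Rabs (fst ((a, b) - u n)%C)) (Rabs (snd ((a, b) - u n)%C))).
  assert (sqrt 2 <= 2) by (rewrite <- (sqrt_square 2) at 2 by lra; apply sqrt_le_1_alt; lra).
  pose proof (sqrt_pos 2). nra. }
specialize (Hc j (N1 + N2)%nat Hj). fold n in Hc.
assert (Cmod ((a, b) - u j) <= Cmod ((a, b) - u n) + Cmod (u n - u j)).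
{ replace ((a, b) - u j)%C with (((a, b) - u n) + (u n - u j))%C by ring. apply Cmod_triangle. }
unfold eps in *; lra.
Qed.

Lemma nat_bound (x : R) : exists n : nat, x <= INR n.
Proof.
destruct (INR_unbounded x) as [n Hn]. exists n; lra.
Qed.

Lemma INR_le_trans (x : R) (k j : nat) : x <= INR k -> (k <= j)%nat -> x <= INR j.
Proof. intros H Hj. apply le_INR in Hj. lra. Qed.

Lemma fast_cauchy_limit (phi : nat -> C -> C) :
  fast_cauchy phi -> exists l, fast_limit phi l.
Proof.
intros H.
assert (E : forall z, exists l : C, forall j, Cmod z <= INR j -> Cmod (l - phi j z) <= (1/2) ^ j).
{ intros z. destruct (nat_bound (Cmod z)) as [k0 Hk0].
  (* Starting from the least admissible index makes a single limit satisfy the estimate for every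
     [j] with [Cmod z <= INR j]. *)
  assert (Hk : exists k, Cmod z <= INR k /\ forall j, Cmod z <= INR j -> (k <= j)%nat).
  { destruct (Wf_nat.dec_inh_nat_subset_has_unique_least_element
       (fun k => Cmod z <= INR k)) as [k [[P Q] _]].
    - intros n. destruct (Rle_dec (Cmod z) (INR n)); auto.
    - exists k0; auto.
    - exists k; auto. }
  destruct Hk as [k [Hk Hmin]].
  destruct (half_cauchy_limit (fun j => phi j z) k) as [l Hl].
  - intros j Hj. apply H. eapply INR_le_trans; eauto.
  - exists l. auto. }
exists (fun z => proj1_sig (constructive_indefinite_description _ (E z))).
intros k z Hz. exact (proj2_sig (constructive_indefinite_description _ (E z)) k Hz).
Qed.

Lemma Cmod_segment (x y : C) (t r : R) :
  0 <= t <= 1 -> Cmod x <= r -> Cmod y <= r -> Cmod (x + RtoC t * (y - x))%C <= r.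
Proof.
intros Ht Hx Hy.
replace (x + RtoC t * (y - x))%C with (RtoC (1 - t) * x + RtoC t * y)%C
  by (rewrite RtoC_minus; ring).
eapply Rle_trans; [apply Cmod_triangle|].
rewrite !Cmod_mult, !Cmod_R, !Rabs_pos_eq by lra. nra.
Qed.

Lemma cderiv_minus (f g : C -> C) (x a b : C) :
  cderiv f x a -> cderiv g x b -> cderiv (fun z => f z - g z)%C x (a - b)%C.
Proof. intros Hf Hg. exact (is_derive_minus f g x a b Hf Hg). Qed.

(** The mean value inequality applied to [phi (N + i) - phi N] bounds its increments by [(1/2) ^ N]
    times the distance, uniformly in [i]. The bound passes to the limit, and the derivative of [l]
    is then read off from that of [phi N]. *)
Lemma fast_limit_derive (phi chi : nat -> C -> C) (l m : C -> C) :
  (forall k z, cderiv (phi k) z (chi k z)) ->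
  fast_cauchy chi -> fast_limit phi l -> fast_limit chi m ->
  forall z, cderiv l z (m z).
Proof.
intros Hd Hc Hl Hm x. apply cderiv_iff. intros eps Heps.
(* Three errors of at most [eps / 4] each: the increment of [l - phi N], the remainder of [phi N],
   and [m x - chi N x]. *)
destruct (half_pow_small (eps / 4)) as [N1 HN1]; [lra|].
destruct (nat_bound (Cmod x + 1)) as [N2 HN2].
set (N := (N1 + N2)%nat).
assert (HN : Cmod x + 1 <= INR N) by (eapply INR_le_trans; [exact HN2|unfold N; lia]).
specialize (HN1 N ltac:(unfold N; lia)).
destruct (proj1 (cderiv_iff _ _ _) (Hd N x) (eps / 4)) as [delta [Hdelta Hphi]]; [lra|].
exists (Rmin 1 delta). split; [apply Rmin_glb_lt; lra|].
intros y Hy.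
assert (Hy1 : Cmod (y - x) < 1) by (eapply Rlt_le_trans; [exact Hy|apply Rmin_l]).
assert (Hy2 : Cmod (y - x) < delta) by (eapply Rlt_le_trans; [exact Hy|apply Rmin_r]).
specialize (Hphi y Hy2).
assert (Py : Cmod y <= INR N).
{ replace y with (x + (y - x))%C by ring. eapply Rle_trans; [apply Cmod_triangle|]. lra. }
assert (Px : Cmod x <= INR N) by lra.
set (r := Cmod (y - x)) in *. pose proof (Cmod_ge_0 (y - x)) as Pr. fold r in Pr.
assert (Hj : forall i, Cmod ((phi (N + i)%nat y - phi N y) - (phi (N + i)%nat x - phi N x)) <= (1/2) ^ N * r).
{ intros i. apply (cmean_value_ineq (fun z => phi (N + i)%nat z - phi N z)%C
    (fun z => chi (N + i)%nat z - chi N z)%C).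
  - intros z. apply cderiv_minus; apply Hd.
  - intros t Ht.
    assert (P := Cmod_segment x y t _ Ht Px Py).
    eapply Rle_trans; [apply (telescope_half (fun j => chi j (x + RtoC t * (y - x))%C))|].
    + intros j Hj. apply Hc. eapply INR_le_trans; eauto.
    + pose proof (half_pow_pos (N + i)). lra. }
assert (HL : Cmod ((l y - phi N y) - (l x - phi N x)) <= (1/2) ^ N * r).
{ apply Rnot_lt_le. intros Hlt.
  set (e := (Cmod ((l y - phi N y) - (l x - phi N x)) - (1/2) ^ N * r) / 4).
  assert (He : 0 < e) by (unfold e; lra).
  destruct (half_pow_small e He) as [K HK].
  specialize (HK (N + K)%nat ltac:(lia)). specialize (Hj K).
  assert (L1 := Hl (N + K)%nat y (INR_le_trans _ N (N + K) Py ltac:(lia))).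
  assert (L2 := Hl (N + K)%nat x (INR_le_trans _ N (N + K) Px ltac:(lia))).
  assert (Cmod ((l y - phi N y) - (l x - phi N x)) <=
    Cmod ((phi (N + K)%nat y - phi N y) - (phi (N + K)%nat x - phi N x))
    + (Cmod (l y - phi (N + K)%nat y) + Cmod (l x - phi (N + K)%nat x))).
  { replace ((l y - phi N y) - (l x - phi N x))%C with
     (((phi (N + K)%nat y - phi N y) - (phi (N + K)%nat x - phi N x)) +
      ((l y - phi (N + K)%nat y) + - (l x - phi (N + K)%nat x)))%C by ring.
    eapply Rle_trans; [apply Cmod_triangle|]. apply Rplus_le_compat_l.
    eapply Rle_trans; [apply Cmod_triangle|]. rewrite Cmod_opp. lra. }
  unfold e in *; lra. }
assert (HM := Hm N x Px).
replace (l y - l x - (y - x) * m x)%C with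
  (((l y - phi N y) - (l x - phi N x)) + ((phi N y - phi N x - (y - x) * chi N x)
    + - ((y - x) * (m x - chi N x))))%C by ring.
eapply Rle_trans; [apply Cmod_triangle|].
eapply Rle_trans; [apply Rplus_le_compat_l, Cmod_triangle|].
rewrite Cmod_opp, Cmod_mult. fold r. nra.
Qed.

(** * Polynomials with arbitrarily large zeros *)

Lemma pow_n_Cpow (z : C) (n : nat) : @pow_n C_Ring z n = (z ^ n)%C.
Proof. induction n; simpl; [reflexivity|]. rewrite IHn. reflexivity. Qed.

Lemma poly_growth (a : nat -> C) (n : nat) :
  exists A, 0 <= A /\ forall z, 1 <= Cmod z ->
    Cmod (sum_n (fun k => Cmult (a k) (pow_n z k)) n) <= A * Cmod z ^ n.
Proof.
induction n as [|n [A [HA H]]].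
- exists (Cmod (a O)). split; [apply Cmod_ge_0|]. intros z _. rewrite sum_O. simpl.
  change (@one C_Ring) with (RtoC 1). rewrite Cmult_1_r. lra.
- exists (A + Cmod (a (S n))). pose proof (Cmod_ge_0 (a (S n))). split; [lra|].
  intros z Hz. rewrite sum_Sn. eapply Rle_trans; [apply Cmod_triangle|].
  rewrite pow_n_Cpow, Cmod_mult, Cmod_pow. specialize (H z Hz).
  rewrite Rmult_plus_distr_r. apply Rplus_le_compat_r.
  eapply Rle_trans; [exact H|]. apply Rmult_le_compat_l; [lra|].
  apply Rle_pow; [lra|lia].
Qed.

(** At a zero [y] the leading term has the modulus of the lower terms, which is at most
    [A * Cmod y ^ n]. For large [y] this forces the leading coefficient to vanish, and the degree
    drops. *)
Lemma poly_zeros_unbounded (a : nat -> C) (n : nat) :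
  (forall k : nat, exists z : C, INR k < Cmod z /\ sum_n (fun k => Cmult (a k) (pow_n z k)) n = RtoC 0) ->
  forall z, sum_n (fun k => Cmult (a k) (pow_n z k)) n = RtoC 0.
Proof.
induction n as [|n IH]; intros H z.
- destruct (H O) as [y [_ Hy]]. rewrite sum_O in Hy |- *. exact Hy.
- assert (Ha : a (S n) = RtoC 0).
  { apply Cmod_eq_0. apply Rle_antisym; [|apply Cmod_ge_0].
    apply Rnot_lt_le. intros Hlt.
    destruct (poly_growth a n) as [A [HA HG]].
    destruct (nat_bound (A / Cmod (a (S n)) + 1)) as [k Hk].
    destruct (H k) as [y [Hy E]].
    assert (0 <= A / Cmod (a (S n))) by (apply Rdiv_le_0_compat; lra).
    specialize (HG y ltac:(lra)). rewrite sum_Sn in E.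
    set (s := sum_n _ n) in *.
    assert (Es : s = (- (a (S n) * pow_n y (S n)))%C).
    { assert (Q : forall u v : C, (u + v = 0)%C -> u = (- v)%C).
      { intros u v Huv. replace u with (u + v - v)%C by ring. rewrite Huv. ring. }
      exact (Q _ _ E). }
    rewrite Es, Cmod_opp, pow_n_Cpow, Cmod_mult, Cmod_pow in HG. simpl in HG.
    assert (P : 0 < Cmod y ^ n) by (apply pow_lt; lra).
    assert (Cmod (a (S n)) * Cmod y <= A).
    { apply Rmult_le_reg_r with (Cmod y ^ n); [exact P|]. lra. }
    assert (A < Cmod y * Cmod (a (S n))).
    { apply Rlt_div_l; lra. }
    lra. }
  assert (E : forall y, sum_n (fun k => Cmult (a k) (pow_n y k)) (S n) = sum_n (fun k => Cmult (a k) (pow_n y k)) n).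
  { intros y. rewrite sum_Sn, Ha, Cmult_0_l. apply (plus_zero_r (G := C_AbelianGroup)). }
  rewrite E. apply IH. intros k. destruct (H k) as [y Hy]. exists y. rewrite <- E. exact Hy.
Qed.

(** * One step of the construction *)

Lemma pow_le_inv (x y : R) (n : nat) : 0 <= y -> (1 <= n)%nat -> x ^ n <= y ^ n -> x <= y.
Proof.
intros Hy Hn H. apply Rnot_lt_le. intros Hlt.
assert (Q : forall m, y ^ S m < x ^ S m).
{ induction m.
  - simpl; lra.
  - change (y * y ^ S m < x * x ^ S m). pose proof (pow_le y (S m) Hy). nra. }
destruct n; [lia|]. specialize (Q n). lra.
Qed.

(** The crude constant [3 ^ m] lets the induction close, since [2 * 3 ^ m + 1 <= 3 ^ S m]. *)
Lemma Cpow_one_sub (x : C) (m : nat) :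
  Cmod x <= 1 -> Cmod ((1 - x) ^ m - 1) <= 3 ^ m * Cmod x.
Proof.
intros Hx. pose proof (Cmod_ge_0 x) as P. induction m.
- simpl. replace (1 - 1)%C with (RtoC 0) by ring. rewrite Cmod_0. lra.
- replace ((1 - x) ^ S m - 1)%C with ((1 - x) * ((1 - x) ^ m - 1) + - x)%C by (simpl; ring).
  eapply Rle_trans; [apply Cmod_triangle|]. rewrite Cmod_mult, Cmod_opp.
  assert (Cmod (1 - x) <= 2).
  { eapply Rle_trans; [apply Cmod_triangle|]. rewrite Cmod_opp, Cmod_1. lra. }
  pose proof (Cmod_ge_0 ((1 - x) ^ m - 1)). pose proof (Cmod_ge_0 (1 - x)).
  assert (1 <= 3 ^ m) by (apply pow_R1_Rle; lra). simpl. nra.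
Qed.

Lemma Cpow_one_sub_second_order (x : C) (m : nat) :
  Cmod x <= 1 -> Cmod (1 - (1 - x) ^ m - RtoC (INR m) * x) <= 3 ^ m * Cmod x ^ 2.
Proof.
intros Hx. pose proof (Cmod_ge_0 x) as P. induction m.
- simpl. replace (1 - 1 - 0 * x)%C with (RtoC 0) by ring. rewrite Cmod_0. nra.
- rewrite S_INR, RtoC_plus.
  replace (1 - (1 - x) ^ S m - (RtoC (INR m) + 1) * x)%C with
    ((1 - (1 - x) ^ m - RtoC (INR m) * x) + x * ((1 - x) ^ m - 1))%C by (simpl; ring).
  eapply Rle_trans; [apply Cmod_triangle|]. rewrite Cmod_mult.
  pose proof (Cpow_one_sub x m Hx).
  assert (0 < 3 ^ m) by (apply pow_lt; lra).
  change (3 ^ S m) with (3 * 3 ^ m). nra.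
Qed.

Lemma Csqrt_exists (y : C) : exists x : C, (x ^ 2 = y)%C.
Proof.
destruct y as [a b].
set (r := Cmod (a, b)).
assert (Hr : r ^ 2 = a ^ 2 + b ^ 2) by (unfold r; rewrite Cmod2_alt; reflexivity).
assert (Pr : 0 <= r) by apply Cmod_ge_0.
assert (Ha : Rabs a <= r) by apply (re_le_Cmod (a, b)).
apply Rabs_le_between in Ha.
(* The half-angle formulas; the sign of the imaginary part is chosen below according to that of
   [b]. *)
set (u := sqrt ((r + a) / 2)). set (v := sqrt ((r - a) / 2)).
assert (Hu : u * u = (r + a) / 2) by (apply sqrt_sqrt; lra).
assert (Hv : v * v = (r - a) / 2) by (apply sqrt_sqrt; lra).
assert (Huv : 2 * (u * v) = Rabs b).
{ unfold u, v. rewrite <- sqrt_mult by lra.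
  replace ((r + a) / 2 * ((r - a) / 2)) with ((Rabs b / 2) * (Rabs b / 2)).
  - rewrite sqrt_square; [field|]. pose proof (Rabs_pos b). lra.
  - assert (Rabs b * Rabs b = b * b) by (rewrite <- Rabs_mult, Rabs_pos_eq; [reflexivity|nra]). nra. }
destruct (Rle_dec 0 b) as [Hb|Hb].
- exists (u, v). rewrite Rabs_pos_eq in Huv by lra.
  unfold Cpow, Cmult; simpl. apply injective_projections; simpl; lra.
- exists (u, - v). rewrite Rabs_left in Huv by lra.
  unfold Cpow, Cmult; simpl. apply injective_projections; simpl; lra.
Qed.

Lemma Croot_pow2 (n : nat) (y : C) : exists x : C, (x ^ (2 ^ n) = y)%C.
Proof.
revert y. induction n; intros y.
- exists y. simpl. ring.
- destruct (Csqrt_exists y) as [s Hs]. destruct (IHn s) as [x Hx]. exists x.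
  rewrite Nat.pow_succ_r', Nat.mul_comm, Cpow_mult_r, Hx. exact Hs.
Qed.

(** [C] carries two normed module structures over itself; the product rule is available for one of
    them, while [cderiv] uses the other. *)
Lemma cderiv_AbsRing (f : C -> C) (x d : C) :
  @is_derive C_AbsRing (AbsRing_NormedModule C_AbsRing) f x d <-> cderiv f x d.
Proof. split; intros [_ H]; split; try apply is_linear_scal_l; exact H. Qed.

Lemma cderiv_mult (f g : C -> C) (x a b : C) :
  cderiv f x a -> cderiv g x b -> cderiv (fun z => f z * g z)%C x (a * g x + f x * b)%C.
Proof.
rewrite <- !cderiv_AbsRing. intros Hf Hg.
exact (@is_derive_mult C_AbsRing f g x a b Hf Hg Cmult_comm).
Qed.

Lemma cderiv_const (a x : C) : cderiv (fun _ => a) x 0.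
Proof. exact (@is_derive_const C_AbsRing C_NormedModule a x). Qed.

Lemma cderiv_id (x : C) : cderiv (fun z => z) x 1.
Proof. apply cderiv_AbsRing. exact (@is_derive_id C_AbsRing x). Qed.

Lemma cderiv_eq (f : C -> C) (x a b : C) : cderiv f x a -> a = b -> cderiv f x b.
Proof. intros H <-; exact H. Qed.

Lemma cderiv_pow (f : C -> C) (x d : C) (m : nat) :
  cderiv f x d -> cderiv (fun z => f z ^ S m)%C x (RtoC (INR (S m)) * f x ^ m * d)%C.
Proof.
intros H. induction m.
- simpl. apply (cderiv_eq _ _ (d * 1 + f x * 0)%C); [|simpl; ring].
  apply cderiv_mult; [exact H|apply cderiv_const].
- eapply cderiv_eq; [exact (cderiv_mult _ _ _ _ _ H IHm)|].
  rewrite (S_INR (S m)), RtoC_plus. simpl. ring.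
Qed.

Definition loc_bdd (f : C -> C) : Prop :=
  forall r : R, exists b : R, forall z, Cmod z <= r -> Cmod (f z) <= b.

Lemma loc_bdd_const (a : C) : loc_bdd (fun _ => a).
Proof. intros r. exists (Cmod a). intros; lra. Qed.

Lemma loc_bdd_minus (f g : C -> C) : loc_bdd f -> loc_bdd g -> loc_bdd (fun z => f z - g z)%C.
Proof.
intros Hf Hg r. destruct (Hf r) as [a Ha]. destruct (Hg r) as [b Hb].
exists (a + b). intros z Hz. eapply Rle_trans; [apply Cmod_triangle|].
rewrite Cmod_opp. specialize (Ha z Hz). specialize (Hb z Hz). lra.
Qed.

Lemma loc_bdd_mult (f g : C -> C) : loc_bdd f -> loc_bdd g -> loc_bdd (fun z => f z * g z)%C.
Proof.
intros Hf Hg r. destruct (Hf r) as [a Ha]. destruct (Hg r) as [b Hb].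
exists (a * b). intros z Hz. rewrite Cmod_mult.
apply Rmult_le_compat; auto using Cmod_ge_0.
Qed.

Lemma loc_bdd_pow (f : C -> C) (m : nat) : loc_bdd f -> loc_bdd (fun z => f z ^ m)%C.
Proof.
intros Hf. induction m.
- exact (loc_bdd_const 1).
- exact (loc_bdd_mult _ _ Hf IHm).
Qed.

Definition proper (f : C -> C) : Prop :=
  forall b : R, exists r : R, forall z, r < Cmod z -> b < Cmod (f z).

(* Tangent to the identity at 0; the only critical point is [q], with value [q/(m+1)]. *)
Definition bump (m : nat) (q : R) (w : C) : C :=
  (RtoC (q / INR (S m)) * (1 - (1 - RtoC (/ q) * w) ^ S m))%C.

Lemma bump_deriv (m : nat) (q : R) (f : C -> C) (x d : C) :
  q <> 0 -> cderiv f x d ->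
  cderiv (fun z => bump m q (f z)) x (d * (1 - RtoC (/ q) * f x) ^ m)%C.
Proof.
intros Hq Hf.
assert (HW : cderiv (fun z => 1 - RtoC (/ q) * f z)%C x (- (RtoC (/ q) * d))%C).
{ apply (cderiv_eq _ _ (0 - (0 * f x + RtoC (/ q) * d))%C); [|ring].
  apply cderiv_minus; [apply cderiv_const|].
  apply (cderiv_mult (fun _ => RtoC (/ q)) f); [apply cderiv_const|exact Hf]. }
eapply cderiv_eq.
- unfold bump.
  apply (cderiv_mult (fun _ => RtoC (q / INR (S m)))); [apply cderiv_const|].
  apply (cderiv_minus (fun _ => RtoC 1)); [apply cderiv_const|].
  apply (cderiv_pow _ _ _ m HW).
- assert (HI : INR (S m) <> 0) by (apply not_0_INR; lia).
  set (W := (1 - RtoC (/ q) * f x)%C).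
  transitivity (RtoC (q / INR (S m) * INR (S m) * / q) * (d * W ^ m))%C.
  + rewrite !RtoC_mult. ring.
  + replace (q / INR (S m) * INR (S m) * / q) with 1 by (field; auto). ring.
Qed.

(** Up to the factor [INR (S m) / q], the right side is the critical value [q / INR (S m)] minus
    [bump m q w]: the distance to the critical value measures a power of the distance to the
    critical point. *)
Lemma bump_value (m : nat) (q : R) (w : C) : 0 < q ->
  ((1 - RtoC (/ q) * w) ^ S m = 1 - RtoC (INR (S m) / q) * bump m q w)%C.
Proof.
intros Hq. unfold bump. rewrite Cmult_assoc, <- RtoC_mult.
assert (HI : INR (S m) <> 0) by (apply not_0_INR; lia).
replace (INR (S m) / q * (q / INR (S m))) with 1 by (field; split; auto with real; lra). ring.
Qed.

(** The linear term of [1 - (1 - x) ^ S m] is exactly undone by the prefactor of [bump], so only the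
    second-order remainder is left. *)
Lemma bump_near_id (m : nat) (q : R) (w : C) :
  0 < q -> Cmod w <= q -> Cmod (bump m q w - w) <= 3 ^ S m * Cmod w ^ 2 / q.
Proof.
intros Hq Hw.
set (x := (RtoC (/ q) * w)%C).
assert (HI : 1 <= INR (S m)) by (rewrite S_INR; pose proof (pos_INR m); lra).
assert (Hx : Cmod x = Cmod w / q).
{ unfold x. rewrite Cmod_mult, Cmod_R, Rabs_pos_eq; [unfold Rdiv; ring|].
  apply Rlt_le, Rinv_0_lt_compat; lra. }
assert (Hx1 : Cmod x <= 1) by (rewrite Hx; apply Rle_div_l; lra).
replace (bump m q w - w)%C with
  (RtoC (q / INR (S m)) * (1 - (1 - x) ^ S m - RtoC (INR (S m)) * x))%C.
- rewrite Cmod_mult, Cmod_R.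
  assert (0 < q / INR (S m)) by (apply Rdiv_lt_0_compat; lra).
  rewrite Rabs_pos_eq by lra.
  pose proof (Cpow_one_sub_second_order x (S m) Hx1) as E.
  apply Rle_trans with (q * (3 ^ S m * Cmod x ^ 2)).
  + apply Rmult_le_compat; try lra; [apply Cmod_ge_0|].
    apply Rle_div_l; [lra|]. nra.
  + rewrite Hx. right. field. lra.
- unfold bump. fold x. set (A := (1 - (1 - x) ^ S m)%C).
  assert (Ew : (RtoC (q / INR (S m)) * (RtoC (INR (S m)) * x) = w)%C).
  { transitivity (RtoC (q / INR (S m) * INR (S m) * / q) * w)%C.
    - unfold x. rewrite !RtoC_mult. ring.
    - replace (q / INR (S m) * INR (S m) * / q) with 1 by (field; lra). ring. }
  rewrite <- Ew. ring.
Qed.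

Lemma bump_surjective (n m : nat) (q : R) (y : C) :
  0 < q -> S m = (2 ^ n)%nat -> exists w, bump m q w = y.
Proof.
intros Hq Hm.
destruct (Croot_pow2 n (1 - RtoC (INR (S m) / q) * y)) as [W HW].
exists (RtoC q * (1 - W))%C. unfold bump.
assert (HI : INR (S m) <> 0) by (apply not_0_INR; lia).
replace (1 - RtoC (/ q) * (RtoC q * (1 - W)))%C with W.
- rewrite Hm, HW, <- Hm.
  transitivity (RtoC (q / INR (S m) * (INR (S m) / q)) * y)%C.
  + rewrite RtoC_mult. ring.
  + replace (q / INR (S m) * (INR (S m) / q)) with 1 by (field; split; auto with real; lra). ring.
- rewrite Cmult_assoc, <- RtoC_mult, Rinv_l by lra. ring.
Qed.

Lemma bump_proper (m : nat) (q : R) (f : C -> C) :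
  0 < q -> proper f -> proper (fun z => bump m q (f z)).
Proof.
intros Hq Hf b.
set (M := INR (S m)).
assert (HM : 1 <= M) by (unfold M; rewrite S_INR; pose proof (pos_INR m); lra).
(* As [Cmod (f z) <= q * (1 + Cmod W)], this threshold gives [Cmod W > 1 + Rabs b * M / q]; the
   power [S m] only enlarges a modulus above 1. *)
destruct (Hf (2 * q + Rabs b * M)) as [r Hr]. exists r. intros z Hz.
specialize (Hr z Hz). pose proof (Rabs_pos b) as Pb.
set (W := (1 - RtoC (/ q) * f z)%C).
assert (HqW : (f z = RtoC q * (1 - W))%C).
{ unfold W. transitivity (RtoC (q * / q) * f z)%C; [rewrite Rinv_r by lra; ring|].
  rewrite RtoC_mult. ring. }
assert (HW : 1 + Rabs b * M / q < Cmod W).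
{ rewrite HqW, Cmod_mult, Cmod_R, (Rabs_pos_eq q) in Hr by lra.
  assert (Cmod (1 - W) <= 1 + Cmod W).
  { eapply Rle_trans; [apply Cmod_triangle|]. rewrite Cmod_opp, Cmod_1. lra. }
  assert (Rabs b * M / q * q = Rabs b * M) by (field; lra).
  apply Rmult_lt_reg_r with q; [lra|]. nra. }
assert (Hb0 : 0 <= Rabs b * M / q).
{ apply Rdiv_le_0_compat; [nra|lra]. }
assert (HWM : Cmod W <= Cmod W ^ S m).
{ pose proof (Rle_pow (Cmod W) 1 (S m) ltac:(lra) ltac:(lia)). simpl in *; lra. }
assert (Ht : Cmod W ^ S m <= 1 + Cmod (1 - W ^ S m)).
{ rewrite <- Cmod_pow. replace (W ^ S m)%C with (1 + - (1 - W ^ S m))%C at 1 by ring.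
  eapply Rle_trans; [apply Cmod_triangle|]. rewrite Cmod_opp, Cmod_1. lra. }
unfold bump. fold W M. rewrite Cmod_mult, Cmod_R.
assert (0 < q / M) by (apply Rdiv_lt_0_compat; lra).
rewrite Rabs_pos_eq by lra.
apply Rle_lt_trans with (Rabs b); [apply Rle_abs|].
apply Rle_lt_trans with (q / M * (Rabs b * M / q)); [right; field; split; lra|].
apply Rmult_lt_compat_l; lra.
Qed.

(* This is the bound [|f'| <= O(|f|^(1-1/n))] valid for polynomials [f] of degree [n]. *)
Definition deriv_growth (n : nat) (f d : C -> C) : Prop :=
  exists c : R, forall z, Cmod (d z) ^ n <= c * (1 + Cmod (f z)) ^ (n - 1).

(** With [X = 1 + Cmod W], both [1 + Cmod (f z) = O(X)] and [X ^ M = O(1 + Cmod (bump m q (f z)))].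
    The claim follows from the count of exponents [(n - 1) * M + m * (n * M) = M * (n * M - 1)]. *)
Lemma deriv_growth_bump (n m : nat) (q : R) (f d : C -> C) :
  0 < q -> (1 <= n)%nat -> deriv_growth n f d ->
  deriv_growth (n * S m) (fun z => bump m q (f z))
    (fun z => d z * (1 - RtoC (/ q) * f z) ^ m)%C.
Proof.
intros Hq Hn [c Hc].
set (M := S m). set (a := 2 ^ M * (2 + INR M / q)).
exists (c ^ M * (q + 1) ^ ((n - 1) * M) * a ^ (n * M - 1)). intros z.
specialize (Hc z).
set (W := (1 - RtoC (/ q) * f z)%C). set (X := 1 + Cmod W).
pose proof (Cmod_ge_0 W) as PW. pose proof (Cmod_ge_0 (f z)) as Pf.
assert (HI : 0 <= INR M / q) by (apply Rdiv_le_0_compat; [apply pos_INR|lra]).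
assert (Pc : 0 <= c).
{ apply Rnot_lt_le. intros Hlt. pose proof (pow_le (Cmod (d z)) n (Cmod_ge_0 _)).
  assert (0 < (1 + Cmod (f z)) ^ (n - 1)) by (apply pow_lt; lra). nra. }
assert (HfX : 1 + Cmod (f z) <= (q + 1) * X).
{ assert (HqW : (f z = RtoC q * (1 - W))%C).
  { unfold W. transitivity (RtoC (q * / q) * f z)%C; [rewrite Rinv_r by lra; ring|].
    rewrite RtoC_mult. ring. }
  rewrite HqW, Cmod_mult, Cmod_R, (Rabs_pos_eq q) by lra.
  assert (Cmod (1 - W) <= X).
  { eapply Rle_trans; [apply Cmod_triangle|]. rewrite Cmod_opp, Cmod_1. unfold X; lra. }
  unfold X in *; nra. }
assert (HXM : X ^ M <= a * (1 + Cmod (bump m q (f z)))).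
{ apply Rle_trans with (2 ^ M * (1 + Cmod W ^ M)).
  - destruct (Rle_dec (Cmod W) 1).
    + apply Rle_trans with (2 ^ M * 1).
      * rewrite Rmult_1_r. apply pow_incr. unfold X; lra.
      * apply Rmult_le_compat_l; [apply pow_le; lra|]. pose proof (pow_le _ M PW). lra.
    + apply Rle_trans with (2 ^ M * Cmod W ^ M).
      * rewrite <- Rpow_mult_distr. apply pow_incr. unfold X; lra.
      * apply Rmult_le_compat_l; [apply pow_le; lra|lra].
  - unfold a. rewrite Rmult_assoc. apply Rmult_le_compat_l; [apply pow_le; lra|].
    rewrite <- Cmod_pow. unfold W, M. rewrite bump_value by lra.
    pose proof (Cmod_ge_0 (bump m q (f z))) as Pb.
    assert (Hb : Cmod (1 - RtoC (INR (S m) / q) * bump m q (f z)) <= 1 + INR (S m) / q * Cmod (bump m q (f z))).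
    { eapply Rle_trans; [apply Cmod_triangle|].
      rewrite Cmod_opp, Cmod_1, Cmod_mult, Cmod_R, Rabs_pos_eq by exact HI. lra. }
    fold M in Hb |- *. nra. }
rewrite Cmod_mult, Cmod_pow, Rpow_mult_distr, (pow_mult (Cmod (d z)) n M). rewrite <- (pow_mult (Cmod W)).
apply Rle_trans with ((c * ((q + 1) * X) ^ (n - 1)) ^ M * X ^ (m * (n * M))).
- apply Rmult_le_compat; try (apply pow_le; auto using Cmod_ge_0, pow_le).
  + apply pow_incr; split; [apply pow_le, Cmod_ge_0|].
    eapply Rle_trans; [exact Hc|]. apply Rmult_le_compat_l; [exact Pc|].
    apply pow_incr; lra.
  + apply pow_incr; unfold X; lra.
- rewrite !Rpow_mult_distr, <- !pow_mult.
  replace (c ^ M * ((q + 1) ^ ((n - 1) * M) * X ^ ((n - 1) * M)) * X ^ (m * (n * M)))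
    with (c ^ M * (q + 1) ^ ((n - 1) * M) * (X ^ M) ^ (n * M - 1)).
  + rewrite (Rmult_assoc _ (a ^ _)), <- Rpow_mult_distr.
    apply Rmult_le_compat_l.
    * apply Rmult_le_pos; apply pow_le; lra.
    * apply pow_incr; split; [apply pow_le; unfold X; lra|exact HXM].
  + rewrite <- pow_mult.
    replace (M * (n * M - 1))%nat with ((n - 1) * M + m * (n * M))%nat.
    * rewrite pow_add. ring.
    * unfold M. destruct n; [lia|]. replace (S n - 1)%nat with n by lia.
      replace (S n * S m - 1)%nat with (n * S m + m)%nat by lia. ring.
Qed.

(** * Stages of the construction and the choice of their parameters *)

(** [fn2] is carried along so that the limit of the [fn1] is itself holomorphic. [rad] is the radius
    in the plane of values of [fn] within which later stages change [fn] by less than 1. *)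
Record stage := Stage { fn : C -> C; fn1 : C -> C; fn2 : C -> C; rad : R }.

(** Surjectivity supplies points with [fn s z = q], the zeros of the next derivative. The values at
    0 survive every bump and keep the limit of the [fn1] from vanishing identically. *)
Record admissible (s : stage) : Prop := {
  adm_deriv1 : forall z, cderiv (fn s) z (fn1 s z);
  adm_deriv2 : forall z, cderiv (fn1 s) z (fn2 s z);
  adm_bdd : loc_bdd (fn s);
  adm_bdd1 : loc_bdd (fn1 s);
  adm_bdd2 : loc_bdd (fn2 s);
  adm_proper : proper (fn s);
  adm_surj : forall y, exists z, fn s z = y;
  adm_growth : exists n, (1 <= n)%nat /\ deriv_growth n (fn s) (fn1 s);
  adm_0 : fn s 0 = 0;
  adm1_0 : fn1 s 0 = 1;
  adm_rad : 0 <= rad s }.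

(** How far below the critical value the observed passage starts. After an error of 1 is subtracted,
    [2 ^ S m * INR k] remains, enough to make [1 - f / q] at the start twice as large as at the
    end. *)
Definition gap (m k : nat) : R := 1 + 2 ^ S m * INR k.

(* The last clause makes a passage of a trajectory near the critical points of [f']
   created at this step last longer than [k]; see [no_fast_escape]. *)
Definition slow_bump (k m : nat) (q : R) (f d f' : C -> C) (b' : R) : Prop :=
  0 < q /\ (forall z, f' z = bump m q (f z)) /\ b' = 2 * (q / INR (S m)) /\
  INR k + gap m k <= q / INR (S m) /\
  exists D, 0 <= D /\ (forall z, Cmod (f z) <= 4 * q -> Cmod (d z) <= D) /\
    (D * (INR k + gap m k)) ^ S m < q ^ m.

(** The first alternative of [step_close] gives convergence on discs. The second concerns values of
    [fn s] and applies to points arbitrarily far out; its margin 1 absorbs the accumulated drift of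
    all stages. *)
Record step (k : nat) (s s' : stage) : Prop := {
  step_close : forall z, Cmod z <= INR k \/ Cmod (fn s z) <= rad s + 1 ->
    Cmod (fn s' z - fn s z) <= (1/2) ^ S k;
  step_close1 : forall z, Cmod z <= INR k -> Cmod (fn1 s' z - fn1 s z) <= (1/2) ^ S k;
  step_close2 : forall z, Cmod z <= INR k -> Cmod (fn2 s' z - fn2 s z) <= (1/2) ^ S k;
  step_rad : rad s + 1 <= rad s';
  step_zeros : forall z, fn1 s z = 0 -> fn1 s' z = 0;
  step_new_zero : exists z, INR k < Cmod z /\ fn1 s' z = 0;
  step_slow : exists m q, slow_bump k m q (fn s) (fn1 s) (fn s') (rad s') }.

(** With [q = r ^ n] the growth condition gives [D] of size [r ^ (n - 1)]. Then [(D * A) ^ S m] is a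
    constant times [r ^ ((n - 1) * S m)], and [n <= m] leaves a spare factor [r] below
    [q ^ m = r ^ (n * m)]. *)
Lemma growth_scale_bound (n m k : nat) (f d : C -> C) (A : R) :
  (1 <= n)%nat -> (n <= m)%nat -> deriv_growth n f d -> 0 <= A ->
  forall K, exists q, K <= q /\ exists D, 0 <= D /\
    (forall z, Cmod (f z) <= 4 * q -> Cmod (d z) <= D) /\ (D * A) ^ S m < q ^ m.
Proof.
intros Hn Hm [c Hc] HA K.
set (a := 5 * Rmax 1 c).
assert (Ha : 1 <= Rmax 1 c) by apply Rmax_l.
assert (Hca : c <= Rmax 1 c) by apply Rmax_r.
(* The summands give in turn [1 <= r], [K <= r ^ n], and a strict bound on the constant
   [(a * A) ^ S m]. *)
set (r := 1 + Rabs K + (a * A) ^ S m).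
assert (HaA : 0 <= (a * A) ^ S m) by (apply pow_le; unfold a; nra).
pose proof (Rabs_pos K) as PK.
assert (Hr : 1 <= r) by (unfold r; lra).
exists (r ^ n).
assert (Hrn : r <= r ^ n).
{ pose proof (Rle_pow r 1 n Hr Hn). simpl in *; lra. }
split; [pose proof (Rle_abs K); unfold r in *; lra|].
exists (a * r ^ (n - 1)).
assert (Hr1 : 0 < r ^ (n - 1)) by (apply pow_lt; lra).
split; [unfold a; nra|]. split.
- intros z Hz.
  apply (pow_le_inv _ _ n); [unfold a; nra|exact Hn|].
  eapply Rle_trans; [apply Hc|].
  apply Rle_trans with (Rmax 1 c * (5 * r ^ n) ^ (n - 1)).
  + apply Rmult_le_compat; [|apply pow_le; pose proof (Cmod_ge_0 (f z)); lra|exact Hca|].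
    * apply Rnot_lt_le. intros Hlt. specialize (Hc z).
      pose proof (pow_le (Cmod (d z)) n (Cmod_ge_0 _)).
      assert (0 < (1 + Cmod (f z)) ^ (n - 1)) by (apply pow_lt; pose proof (Cmod_ge_0 (f z)); lra). nra.
    * apply pow_incr. pose proof (Cmod_ge_0 (f z)); lra.
  + rewrite !Rpow_mult_distr. unfold a. rewrite Rpow_mult_distr.
    rewrite <- !pow_mult, (Nat.mul_comm n (n - 1)), <- Rmult_assoc.
    apply Rmult_le_compat_r; [apply pow_le; lra|].
    rewrite Rmult_comm. apply Rmult_le_compat; [apply pow_le; lra|lra| |].
    * apply Rle_pow; [lra|lia].
    * pose proof (Rle_pow _ 1 n Ha Hn). simpl in *; lra.
- replace (a * r ^ (n - 1) * A) with (a * A * r ^ (n - 1)) by ring.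
  rewrite Rpow_mult_distr, <- !pow_mult.
  apply Rlt_le_trans with (r * r ^ ((n - 1) * S m)).
  + apply Rmult_lt_compat_r; [apply pow_lt; lra|unfold r; lra].
  + change (r ^ S ((n - 1) * S m) <= r ^ (n * m)). apply Rle_pow; [lra|].
    destruct n; [lia|]. simpl (S n - 1)%nat. rewrite Nat.sub_0_r. nia.
Qed.

Lemma div_le_half_pow (k : nat) (x q : R) : 0 < q -> 2 ^ S k * x <= q -> x / q <= (1/2) ^ S k.
Proof.
intros Hq H. apply Rle_div_l; [lra|].
assert (P : 0 < 2 ^ S k) by (apply pow_lt; lra).
replace ((1/2) ^ S k) with (/ 2 ^ S k).
- apply Rmult_le_reg_l with (2 ^ S k); [exact P|].
  rewrite <- Rmult_assoc, Rinv_r; lra.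
- rewrite <- pow_inv. f_equal. lra.
Qed.

Lemma pow2_gt (n : nat) : (n < 2 ^ n)%nat.
Proof. apply Nat.pow_gt_lin_r; lia. Qed.

Lemma step_exists (k : nat) (s : stage) :
  admissible s -> exists s', admissible s' /\ step k s s'.
Proof.
intros [Hd1 Hd2 Hb Hb1 Hb2 Hp Hs [n [Hn Hg]] H0 H10 Hrad].
destruct s as [f d e B]; simpl in *.
pose proof (pow2_gt n) as H2n.
(* The multiplicity is [S m = 2 ^ n], so [n <= m]; moreover [m] is a successor [S p], where [p] is
   the exponent in the second derivative. *)
destruct (2 ^ n)%nat as [|m] eqn:Em; [lia|].
destruct m as [|p]; [lia|].
remember (S p) as m eqn:Hpm.
destruct (Hb (INR k)) as [b1 Hb1']. destruct (Hb1 (INR k)) as [b2 Hb2'].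
destruct (Hb2 (INR k)) as [b3 Hb3'].
(* Bounds [rad s + 1] as well as [f] and its first two derivatives on the disc of radius [INR k]. *)
set (b := 1 + B + Rabs b1 + Rabs b2 + Rabs b3).
pose proof (Rabs_pos b1). pose proof (Rabs_pos b2). pose proof (Rabs_pos b3).
pose proof (Rle_abs b1). pose proof (Rle_abs b2). pose proof (Rle_abs b3).
pose proof (pos_INR k) as Pk.
assert (HM : 1 <= INR (S m)) by (rewrite S_INR; pose proof (pos_INR m); lra).
assert (Hgap : 1 <= gap m k).
{ unfold gap. assert (0 < 2 ^ S m) by (apply pow_lt; lra). nra. }
assert (P3 : 1 <= 3 ^ S m) by (apply pow_R1_Rle; lra).
assert (P2 : 1 <= 2 ^ S k) by (apply pow_R1_Rle; lra).
assert (Pp : 1 <= 2 ^ p) by (apply pow_R1_Rle; lra).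
assert (Hbb : 1 <= b) by (unfold b; lra).
(* The three summands serve in turn the closeness bounds [(1/2) ^ S k], the inequality [b < q], and
   the room required of [q / INR (S m)] by [slow_bump] and [step_rad]. *)
set (K := 2 ^ S k * (3 ^ S m * b ^ 2 + INR m * 2 ^ p * b ^ 2) + b
   + INR (S m) * (INR k + gap m k + B + 1)).
destruct (growth_scale_bound n m k f d (INR k + gap m k) Hn ltac:(lia) Hg ltac:(lra) K)
  as [q [HKq [D [HD0 [HD HDq]]]]].
pose proof (pos_INR m) as Pm.
assert (T1 : 0 <= 3 ^ S m * b ^ 2) by nra.
assert (T2 : 0 <= INR m * 2 ^ p * b ^ 2).
{ apply Rmult_le_pos; [apply Rmult_le_pos; lra|nra]. }
assert (Hqb : b < q) by (unfold K in HKq; nra).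
assert (Hq : 0 < q) by lra.
assert (HqM : INR k + gap m k + B + 1 <= q / INR (S m)).
{ apply Rle_div_r; [lra|]. unfold K in HKq. nra. }
assert (Hq2 : 2 ^ S k * (3 ^ S m * b ^ 2 + INR m * 2 ^ p * b ^ 2) <= q).
{ unfold K in HKq. nra. }
clear HKq K.
set (W := fun z => (1 - RtoC (/ q) * f z)%C).
assert (HdW : forall z, cderiv W z (- (RtoC (/ q) * d z))%C).
{ intros z. apply (cderiv_eq _ _ (0 - (0 * f z + RtoC (/ q) * d z))%C); [|ring].
  apply cderiv_minus; [apply cderiv_const|].
  apply (cderiv_mult (fun _ => RtoC (/ q)) f); [apply cderiv_const|apply Hd1]. }
assert (HbW : loc_bdd W).
{ apply loc_bdd_minus; [apply loc_bdd_const|]. apply loc_bdd_mult; [apply loc_bdd_const|exact Hb]. }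
set (e' := fun z => (e z * W z ^ m - d z * d z * (RtoC (INR m * / q) * W z ^ p))%C).
exists (Stage (fun z => bump m q (f z)) (fun z => d z * W z ^ m)%C e' (2 * (q / INR (S m)))).
assert (HWq : forall z, Cmod (f z) <= b -> Cmod (RtoC (/ q) * f z) <= b / q /\ b / q <= 1).
{ intros z Hz. split.
  - rewrite Cmod_mult, Cmod_R, Rabs_pos_eq by (apply Rlt_le, Rinv_0_lt_compat; lra).
    unfold Rdiv. rewrite Rmult_comm. apply Rmult_le_compat_r; [apply Rlt_le, Rinv_0_lt_compat; lra|exact Hz].
  - apply Rle_div_l; lra. }
assert (HWm : forall z, Cmod (f z) <= b -> Cmod (W z ^ m - 1) <= 3 ^ m * (b / q)).
{ intros z Hz. destruct (HWq z Hz) as [Q1 Q2].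
  eapply Rle_trans; [apply Cpow_one_sub; lra|].
  apply Rmult_le_compat_l; [apply pow_le; lra|exact Q1]. }
assert (Hiq : 0 < b / q) by (apply Rdiv_lt_0_compat; lra).
assert (H3m : 3 ^ m <= 3 ^ S m) by (apply Rle_pow; [lra|lia]).
assert (H3m0 : 0 < 3 ^ m) by (apply pow_lt; lra).
split; constructor; cbn [fn fn1 fn2 rad].
- intros z. exact (bump_deriv m q f z (d z) ltac:(lra) (Hd1 z)).
- intros z. eapply cderiv_eq.
  + rewrite Hpm. apply (cderiv_mult d); [apply Hd2|]. apply cderiv_pow. apply HdW.
  + unfold e'. rewrite RtoC_mult, Hpm. simpl. ring.
- apply loc_bdd_mult; [apply loc_bdd_const|].
  apply loc_bdd_minus; [apply loc_bdd_const|]. exact (loc_bdd_pow _ (S m) HbW).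
- apply loc_bdd_mult; [exact Hb1|]. exact (loc_bdd_pow _ m HbW).
- apply loc_bdd_minus; [exact (loc_bdd_mult _ _ Hb2 (loc_bdd_pow _ m HbW))|].
  apply loc_bdd_mult; [exact (loc_bdd_mult _ _ Hb1 Hb1)|].
  apply loc_bdd_mult; [apply loc_bdd_const|exact (loc_bdd_pow _ p HbW)].
- apply bump_proper; assumption.
- intros y. destruct (bump_surjective n m q y Hq ltac:(lia)) as [w Hw].
  destruct (Hs w) as [z Hz]. exists z. rewrite Hz. exact Hw.
- exists (n * S m)%nat. split; [nia|]. apply deriv_growth_bump; assumption.
- rewrite H0. unfold bump. rewrite Cmult_0_r. replace (1 - 0)%C with (RtoC 1) by ring.
  rewrite Cpow_1_l. ring.
- unfold W. rewrite H0, H10, Cmult_0_r. replace (1 - 0)%C with (RtoC 1) by ring.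
  rewrite Cpow_1_l. ring.
- lra.
- intros z Hz.
  assert (Hfz : Cmod (f z) <= b).
  { destruct Hz as [Hz|Hz]; [specialize (Hb1' z Hz)|]; unfold b; lra. }
  eapply Rle_trans; [apply bump_near_id; lra|].
  apply div_le_half_pow; [lra|].
  eapply Rle_trans; [|exact Hq2]. apply Rmult_le_compat_l; [lra|].
  assert (Cmod (f z) ^ 2 <= b ^ 2) by (apply pow_incr; split; [apply Cmod_ge_0|lra]).
  nra.
- intros z Hz.
  assert (Hfz : Cmod (f z) <= b) by (specialize (Hb1' z Hz); unfold b; lra).
  assert (Hdz : Cmod (d z) <= b) by (specialize (Hb2' z Hz); unfold b; lra).
  replace (d z * W z ^ m - d z)%C with (d z * (W z ^ m - 1))%C by ring.
  rewrite Cmod_mult.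
  apply Rle_trans with (b * (3 ^ m * (b / q))).
  { apply Rmult_le_compat; auto using Cmod_ge_0. }
  replace (b * (3 ^ m * (b / q))) with (3 ^ m * b ^ 2 / q) by (field; lra).
  apply div_le_half_pow; [lra|]. eapply Rle_trans; [|exact Hq2].
  apply Rmult_le_compat_l; [lra|]. nra.
- intros z Hz.
  assert (Hfz : Cmod (f z) <= b) by (specialize (Hb1' z Hz); unfold b; lra).
  assert (Hdz : Cmod (d z) <= b) by (specialize (Hb2' z Hz); unfold b; lra).
  assert (Hez : Cmod (e z) <= b) by (specialize (Hb3' z Hz); unfold b; lra).
  unfold e'.
  replace (e z * W z ^ m - d z * d z * (RtoC (INR m * / q) * W z ^ p) - e z)%C with
    (e z * (W z ^ m - 1) + - (d z * d z * (RtoC (INR m * / q) * W z ^ p)))%C by ring.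
  eapply Rle_trans; [apply Cmod_triangle|].
  rewrite Cmod_opp, !Cmod_mult, Cmod_pow, Cmod_R, Rabs_pos_eq.
  2:{ apply Rmult_le_pos; [lra|apply Rlt_le, Rinv_0_lt_compat; lra]. }
  assert (HW2 : Cmod (W z) <= 2).
  { destruct (HWq z Hfz). unfold W. eapply Rle_trans; [apply Cmod_triangle|].
    rewrite Cmod_opp, Cmod_1. lra. }
  apply Rle_trans with (b * (3 ^ m * (b / q)) + b * b * (INR m * / q * 2 ^ p)).
  { apply Rplus_le_compat.
    - apply Rmult_le_compat; auto using Cmod_ge_0.
    - apply Rmult_le_compat.
      + apply Rmult_le_pos; apply Cmod_ge_0.
      + apply Rmult_le_pos; [|apply pow_le, Cmod_ge_0].
        apply Rmult_le_pos; [lra|apply Rlt_le, Rinv_0_lt_compat; lra].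
      + apply Rmult_le_compat; auto using Cmod_ge_0.
      + apply Rmult_le_compat_l.
        * apply Rmult_le_pos; [lra|apply Rlt_le, Rinv_0_lt_compat; lra].
        * apply pow_incr; split; [apply Cmod_ge_0|exact HW2]. }
  replace (b * (3 ^ m * (b / q)) + b * b * (INR m * / q * 2 ^ p))
    with ((3 ^ m * b ^ 2 + INR m * 2 ^ p * b ^ 2) / q) by (field; lra).
  apply div_le_half_pow; [lra|]. eapply Rle_trans; [|exact Hq2].
  apply Rmult_le_compat_l; [lra|]. nra.
- lra.
- intros z Hz. rewrite Hz. ring.
(* Where [f z = q] the factor [W] vanishes; such a [z] lies outside the disc because
   [Cmod (f z) <= b < q] inside it. *)
- destruct (Hs (RtoC q)) as [z Hz]. exists z. split.
  + apply Rnot_le_lt. intros Hle. specialize (Hb1' z Hle).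
    rewrite Hz, Cmod_R, Rabs_pos_eq in Hb1' by lra. unfold b in Hqb. lra.
  + unfold W. rewrite Hz, <- RtoC_mult, Rinv_l by lra.
    rewrite Hpm. simpl. ring.
- exists m, q. repeat split; try assumption; try lra.
  exists D. auto.
Qed.

Lemma admissible_id : admissible (Stage (fun z => z) (fun _ => 1) (fun _ => 0) 0).
Proof.
constructor; simpl; try reflexivity; try lra.
- intros; apply cderiv_id.
- intros; apply cderiv_const.
- intros r. exists r. auto.
- apply loc_bdd_const.
- apply loc_bdd_const.
- intros b. exists b. auto.
- intros y. exists y. reflexivity.
- exists 1%nat. split; [lia|]. exists 1. intros z. rewrite Cmod_1. simpl. lra.
Qed.

(** Recursion on stages paired with their admissibility proofs, each step being chosen from
    [step_exists]. *)
Lemma stage_sequence : exists s : nat -> stage,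
  (forall k, admissible (s k)) /\ (forall k, step k (s k) (s (S k))).
Proof.
set (next := fun (k : nat) (x : sig admissible) =>
  constructive_indefinite_description _ (step_exists k (proj1_sig x) (proj2_sig x))).
set (sq := nat_rect (fun _ => sig admissible) (exist _ _ admissible_id)
  (fun k x => exist admissible (proj1_sig (next k x)) (proj1 (proj2_sig (next k x))))).
exists (fun k => proj1_sig (sq k)). split.
- intros k. exact (proj2_sig (sq k)).
- intros k. exact (proj2 (proj2_sig (next k (sq k)))).
Qed.

(** * Trajectories *)

(** Strengthens the intermediate value theorem by the bound up to the hitting time: [c] is the
    supremum of the times before which [h] stays at most [L]. *)
Lemma first_hit (h : R -> R) (a b L : R) :
  a <= b -> (forall t, a <= t <= b -> continuity_pt h t) -> h a < L -> L <= h b ->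
  exists c, a <= c <= b /\ h c = L /\ forall s, a <= s <= c -> h s <= L.
Proof.
intros Hab Hc Ha Hb.
set (E := fun t => a <= t <= b /\ forall s, a <= s <= t -> h s <= L).
assert (Ea : E a).
{ split; [lra|]. intros s Hs. replace s with a by lra. lra. }
destruct (completeness E) as [c [Hub Hlub]].
- exists b. intros t [Ht _]. lra.
- exists a. exact Ea.
- assert (Hac : a <= c) by (apply Hub; exact Ea).
  assert (Hcb : c <= b) by (apply Hlub; intros t [Ht _]; lra).
  assert (Hbelow : forall s, a <= s < c -> h s <= L).
  { intros s Hs. apply Rnot_lt_le. intros Hlt.
    assert (c <= s); [|lra]. apply Hlub. intros t [Ht1 Ht2].
    apply Rnot_lt_le. intros Hst. specialize (Ht2 s ltac:(lra)). lra. }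
  assert (Hnear : forall eps, 0 < eps -> exists delta, 0 < delta /\
     forall t, Rabs (t - c) < delta -> Rabs (h t - h c) < eps).
  { intros eps He. destruct (Hc c ltac:(lra) eps He) as [delta [Hd1 Hd2]].
    exists delta. split; [exact Hd1|]. intros t Ht.
    destruct (Req_dec t c) as [->|Hne].
    - replace (h c - h c) with 0 by ring. rewrite Rabs_R0. exact He.
    - apply Hd2. split; [split; [exact I|auto]|exact Ht]. }
  assert (HcL : h c <= L).
  { apply Rnot_lt_le. intros Hlt.
    destruct (Hnear (h c - L) ltac:(lra)) as [delta [Hd1 Hd2]].
    assert (Hne : a < c) by (destruct Hac as [|Heq]; [assumption|rewrite <- Heq in Hlt; lra]).
    set (s := Rmax a (c - delta / 2)).
    assert (Hs : a <= s < c) by (unfold s; split; [apply Rmax_l|apply Rmax_lub_lt; lra]).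
    assert (c - delta / 2 <= s) by apply Rmax_r.
    specialize (Hbelow s Hs). specialize (Hd2 s).
    rewrite Rabs_left in Hd2 by lra. specialize (Hd2 ltac:(lra)).
    apply Rabs_def2 in Hd2. lra. }
  exists c. split; [lra|]. split.
  + apply Rle_antisym; [exact HcL|]. apply Rnot_lt_le. intros Hlt.
    destruct (Hnear (L - h c) ltac:(lra)) as [delta [Hd1 Hd2]].
    assert (Hne : c < b) by (destruct Hcb as [|Heq]; [assumption|rewrite Heq in Hlt; lra]).
    set (s := Rmin b (c + delta / 2)).
    assert (Hs : c < s <= b) by (unfold s; split; [apply Rmin_glb_lt; lra|apply Rmin_l]).
    assert (Hs2 : s <= c + delta / 2) by apply Rmin_r.
    assert (s <= c); [|lra]. apply Hub. split; [lra|]. intros t Ht.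
    destruct (Rlt_dec t c); [apply Hbelow; lra|].
    specialize (Hd2 t). rewrite Rabs_pos_eq in Hd2 by lra. specialize (Hd2 ltac:(lra)).
    apply Rabs_def2 in Hd2. lra.
  + intros s Hs. destruct (Rlt_dec s c); [apply Hbelow; lra|].
    replace s with c by lra. exact HcL.
Qed.

Lemma pderiv_Cmod_continuous (z : R -> C) (t : R) (d : C) :
  pderiv z t d -> continuity_pt (fun s => Cmod (z s)) t.
Proof.
intros Hz. destruct (proj1 (pderiv_iff z t d) Hz 1 Rlt_0_1) as [delta [Hd1 Hd2]].
pose proof (Cmod_ge_0 d) as Pd.
intros eps Heps. exists (Rmin delta (eps / (Cmod d + 2))). split.
{ apply Rmin_glb_lt; [exact Hd1|]. apply Rdiv_lt_0_compat; lra. }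
intros s [_ Hs]. simpl in *. unfold R_dist in *.
assert (Hs1 : Rabs (s - t) < delta) by (eapply Rlt_le_trans; [exact Hs|apply Rmin_l]).
assert (Hs2 : Rabs (s - t) < eps / (Cmod d + 2)) by (eapply Rlt_le_trans; [exact Hs|apply Rmin_r]).
apply Rlt_div_r in Hs2; [|lra]. specialize (Hd2 s Hs1).
assert (Cmod (z s - z t) <= (Cmod d + 1) * Rabs (s - t)).
{ replace (z s - z t)%C with ((z s - z t - RtoC (s - t) * d) + RtoC (s - t) * d)%C by ring.
  eapply Rle_trans; [apply Cmod_triangle|]. rewrite Cmod_mult, Cmod_R. lra. }
assert (Cmod (z s) <= Cmod (z t) + Cmod (z s - z t)).
{ replace (z s) with (z t + (z s - z t))%C at 1 by ring. apply Cmod_triangle. }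
assert (Cmod (z t) <= Cmod (z s) + Cmod (z s - z t)).
{ replace (z t) with (z s + - (z s - z t))%C at 1 by ring.
  eapply Rle_trans; [apply Cmod_triangle|]. rewrite Cmod_opp. lra. }
pose proof (Rabs_pos (s - t)).
apply Rabs_def1; nra.
Qed.

Lemma is_derive_continuity (h : R -> R) (t l : R) : is_derive h t l -> continuity_pt h t.
Proof.
intros H. apply continuity_pt_filterlim.
apply (@ex_derive_continuous R_AbsRing R_NormedModule). exists l. exact H.
Qed.

Section GradientFlow.

Variables (G g : C -> C) (z : R -> C) (t0 beta : R).
Hypothesis HG : forall w, cderiv G w (g w).
Hypothesis Hz : forall t, t0 <= t < beta -> pderiv z t (Cconj (g (z t))).

Lemma flow_Re_derive (t : R) : t0 <= t < beta ->
  is_derive (fun s => Re (G (z s))) t (Cmod (g (z t)) ^ 2).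
Proof.
intros Ht.
pose proof (pderiv_Re _ _ _ 1 (pderiv_comp G z t _ _ (HG _) (Hz t Ht))) as H.
replace (Cmod (g (z t)) ^ 2) with (Re (1 * (g (z t) * Cconj (g (z t))))).
- eapply is_derive_ext; [|exact H]. intros s. cbv beta. now rewrite Cmult_1_l.
- rewrite Cmod2_alt. destruct (g (z t)). unfold Re, Im, Cmult, Cconj; simpl. ring.
Qed.

Lemma flow_Re_le (s t : R) : t0 <= s <= t -> t < beta -> Re (G (z s)) <= Re (G (z t)).
Proof.
intros Hst Ht.
apply (is_derive_nonneg_le (fun s => Re (G (z s))) (fun s => Cmod (g (z s)) ^ 2)); [lra| |].
- intros r Hr. apply flow_Re_derive; lra.
- intros r Hr. apply pow_le, Cmod_ge_0.
Qed.

(** The derivative of [G] along the flow is [g] times its conjugate, hence real. So [Re (w * G)] has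
    derivative zero for imaginary [w], and [w = Ci] and [w = - Ci] give the two inequalities. *)
Lemma flow_Im_const (t : R) : t0 <= t < beta -> Im (G (z t)) = Im (G (z t0)).
Proof.
intros Ht.
assert (H : forall w : C, Re w = 0 -> Re (w * G (z t0)) <= Re (w * G (z t))).
{ intros w Hw.
  apply (is_derive_nonneg_le (fun s => Re (w * G (z s)))
    (fun s => Re (w * (g (z s) * Cconj (g (z s)))))); [lra| |].
  - intros r Hr. apply pderiv_Re. apply (pderiv_comp G); [apply HG|apply Hz; lra].
  - intros r Hr. rewrite <- Cmod2_conj. destruct w as [w1 w2].
    unfold Re in *; simpl in *. subst w1. lra. }
pose proof (H Ci eq_refl) as H1. pose proof (H (- Ci)%C ltac:(unfold Re; simpl; ring)) as H2.
revert H1 H2. destruct (G (z t0)), (G (z t)). unfold Re, Im; simpl. lra.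
Qed.

(* [|g| <= 1 + |g|^2], where [|g|] is the speed of the trajectory and [|g|^2] the
   derivative of [Re G] along it. *)
Lemma flow_displacement (f d : C -> C) (D s t : R) :
  (forall w, cderiv f w (d w)) -> 0 <= D -> t0 <= s <= t -> t < beta ->
  (forall r, s <= r <= t -> Cmod (d (z r)) <= D) ->
  Cmod (f (z t) - f (z s)) <= D * ((t - s) + (Re (G (z t)) - Re (G (z s)))).
Proof.
intros Hf HD Hst Ht Hd.
replace (D * ((t - s) + (Re (G (z t)) - Re (G (z s))))) with
  (D * (t + Re (G (z t))) - D * (s + Re (G (z s)))) by ring.
apply (mean_value_ineq (fun r => f (z r)) (fun r => d (z r) * Cconj (g (z r)))%C
  (fun r => D * (r + Re (G (z r)))) (fun r => D * (1 + Cmod (g (z r)) ^ 2))); [lra| | |].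
- intros r Hr. apply (pderiv_comp f); [apply Hf|apply Hz; lra].
- intros r Hr. apply is_derive_scal. apply (is_derive_plus (V := R_NormedModule)).
  + apply (is_derive_id (K := R_AbsRing)).
  + apply flow_Re_derive; lra.
- intros r Hr. rewrite Cmod_mult, Cmod_conj.
  specialize (Hd r Hr). pose proof (Cmod_ge_0 (g (z r))). pose proof (Cmod_ge_0 (d (z r))).
  apply Rmult_le_compat; try lra. nra.
Qed.

(** Times [s <= t1 <= t2 <= t3] are located between [t0] and [beta]. On [[s, t1]] the displacement
    [Delta] of [f] satisfies [q ^ m <= Delta ^ S m] by geometry and [Delta <= D * (INR k + gap m k)]
    by the short duration, against the last clause of [slow_bump]. *)
Lemma no_fast_escape (k m : nat) (q b' : R) (f d f' : C -> C) :
  slow_bump k m q f d f' b' ->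
  (forall w, cderiv f w (d w)) -> proper f' ->
  (forall w, Cmod (f' w) <= b' -> Cmod (G w - f' w) <= 1) ->
  t0 < beta ->
  filterlim (fun t => Cmod (z t)) (at_left beta) (Rbar_locally p_infty) ->
  Cmod (G (z t0)) + 1 <= INR k -> beta - t0 <= INR k -> Cmod (f' (z t0)) <= INR k ->
  False.
Proof.
intros [Hq [Hf' [Hb' [Hkap [D [HD0 [HD HDq]]]]]]] Hf Hp Happ Ht0 Hlim HkG Hkb Hkf.
set (kap := q / INR (S m)) in *. subst b'.
assert (HM : 1 <= INR (S m)) by (rewrite S_INR; pose proof (pos_INR m); lra).
pose proof (Cmod_ge_0 (G (z t0))) as PG.
assert (HS : gap m k = 1 + 2 ^ S m * INR k) by reflexivity.
set (S0 := gap m k) in *.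
assert (HP2 : 2 <= 2 ^ S m).
{ pose proof (Rle_pow 2 1 (S m) ltac:(lra) ltac:(lia)). simpl in *; lra. }
assert (HS1 : 1 + 2 * INR k <= S0) by nra.
assert (Hqk : q = INR (S m) * kap) by (unfold kap; field; lra).
assert (Ht3 : exists t3, t0 <= t3 < beta /\ 2 * kap <= Cmod (f' (z t3))).
{ destruct (Hp (2 * kap)) as [r Hr].
  specialize (Hlim (fun x => r < x)). destruct Hlim as [delta Hdelta].
  { exists r. auto. }
  set (t3 := Rmax t0 (beta - delta / 2)).
  assert (Hd := cond_pos delta).
  assert (t0 <= t3) by apply Rmax_l.
  assert (beta - delta / 2 <= t3) by apply Rmax_r.
  assert (t3 < beta) by (apply Rmax_lub_lt; lra).
  exists t3. split; [lra|]. left. apply Hr. apply Hdelta; [|lra].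
  unfold ball; simpl. unfold AbsRing_ball, abs, minus, plus, opp; simpl.
  apply Rabs_def1; lra. }
destruct Ht3 as [t3 [Ht3 Hbig]].
(* Up to this first time the trajectory stays where [f'] approximates [G] within 1. *)
destruct (first_hit (fun t => Cmod (f' (z t))) t0 t3 (2 * kap)) as [t2 [Ht2 [E2 Hin]]]; try lra.
{ intros t Ht. apply continuity_pt_ext with (fun s => Cmod (bump m q (f (z s)))).
  - intros s. rewrite Hf'. reflexivity.
  - eapply (pderiv_Cmod_continuous (fun s => bump m q (f (z s)))).
    apply (pderiv_comp (fun w => bump m q (f w))); [|apply Hz; lra].
    apply bump_deriv; [lra|apply Hf]. }
assert (Hap : forall t, t0 <= t <= t2 -> Cmod (G (z t) - f' (z t)) <= 1).
{ intros t Ht. apply Happ. apply Hin. exact Ht. }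
set (c := Im (G (z t0))) in *.
assert (Him : forall t, t0 <= t <= t2 -> Im (G (z t)) = c).
{ intros t Ht. apply flow_Im_const. lra. }
assert (Hc : Rabs c <= Cmod (G (z t0))).
{ eapply Rle_trans; [apply Rmax_r|apply Rmax_Cmod]. }
assert (HRe0 : Rabs (Re (G (z t0))) <= Cmod (G (z t0))) by apply re_le_Cmod.
apply Rabs_le_between in HRe0.
assert (Hshift : forall t, t0 <= t <= t2 ->
  Cmod (G (z t) - RtoC kap) <= Rabs (Re (G (z t)) - kap) + Rabs c).
{ intros t Ht. rewrite <- (Him t Ht).
  replace (G (z t) - RtoC kap)%C with (RtoC (Re (G (z t)) - kap) + Ci * RtoC (Im (G (z t))))%C.
  - eapply Rle_trans; [apply Cmod_triangle|]. rewrite Cmod_mult, Cmod_Ci, !Cmod_R. lra.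
  - destruct (G (z t)). unfold RtoC, Ci, Re, Im, Cplus, Cmult, Cminus, Copp; simpl.
    apply injective_projections; simpl; ring. }
assert (Hfk : forall t, t0 <= t <= t2 ->
  Rabs (Cmod (f' (z t) - RtoC kap) - Cmod (G (z t) - RtoC kap)) <= 1).
{ intros t Ht. specialize (Hap t Ht). apply Rabs_le_between. split.
  - assert (Cmod (G (z t) - RtoC kap) <= Cmod (f' (z t) - RtoC kap) + Cmod (G (z t) - f' (z t))); [|lra].
    replace (G (z t) - RtoC kap)%C with ((f' (z t) - RtoC kap) + (G (z t) - f' (z t)))%C by ring.
    apply Cmod_triangle.
  - assert (Cmod (f' (z t) - RtoC kap) <= Cmod (G (z t) - RtoC kap) + Cmod (G (z t) - f' (z t))); [|lra].
    replace (f' (z t) - RtoC kap)%C with ((G (z t) - RtoC kap) + - (G (z t) - f' (z t)))%C by ring.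
    eapply Rle_trans; [apply Cmod_triangle|]. rewrite Cmod_opp. lra. }
(* Otherwise [Re (G (z t2))] lies between [- kap] and [kap], and with the constant imaginary part
   [c] this makes [Cmod (f' (z t2))] smaller than [2 * kap]. *)
assert (Ht2k : kap <= Re (G (z t2))).
{ apply Rnot_lt_le. intros Hlt.
  pose proof (flow_Re_le t0 t2 ltac:(lra) ltac:(lra)) as Hmono.
  assert (Cmod (G (z t2)) <= Rabs (Re (G (z t2))) + Rabs c).
  { rewrite <- (Him t2 ltac:(lra)).
    replace (G (z t2)) with (RtoC (Re (G (z t2))) + Ci * RtoC (Im (G (z t2))))%C at 1.
    - eapply Rle_trans; [apply Cmod_triangle|]. rewrite Cmod_mult, Cmod_Ci, !Cmod_R. lra.
    - destruct (G (z t2)). unfold RtoC, Ci, Re, Im, Cplus, Cmult; simpl.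
      apply injective_projections; simpl; ring. }
  assert (Cmod (f' (z t2)) <= Cmod (G (z t2)) + 1).
  { specialize (Hap t2 ltac:(lra)).
    replace (f' (z t2)) with (G (z t2) + - (G (z t2) - f' (z t2)))%C by ring.
    eapply Rle_trans; [apply Cmod_triangle|]. rewrite Cmod_opp. lra. }
  assert (Rabs (Re (G (z t2))) <= kap) by (apply Rabs_le_between; lra).
  lra. }
assert (Hcont : forall t, t0 <= t <= t2 -> continuity_pt (fun s => Re (G (z s))) t).
{ intros t Ht. eapply is_derive_continuity. apply flow_Re_derive. lra. }
destruct (first_hit (fun s => Re (G (z s))) t0 t2 kap) as [t1 [Ht1 [E1 _]]]; try assumption; try lra.
destruct (first_hit (fun s => Re (G (z s))) t0 t1 (kap - S0)) as [s [Hs [Es _]]]; try lra.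
{ intros t Ht. apply Hcont; lra. }
simpl in E1, Es.
set (W := fun t => (1 - RtoC (/ q) * f (z t))%C).
assert (HW : forall t, Cmod (W t) ^ S m * kap = Cmod (f' (z t) - RtoC kap)).
{ intros t. rewrite <- Cmod_pow. unfold W. rewrite bump_value by exact Hq. rewrite <- Hf'.
  replace (INR (S m) / q) with (/ kap) by (rewrite Hqk; field; lra).
  replace kap with (Cmod (RtoC kap)) at 2 by (rewrite Cmod_R; apply Rabs_pos_eq; lra).
  rewrite <- Cmod_mult, <- (Cmod_opp (f' (z t) - RtoC kap)). f_equal.
  transitivity (RtoC kap - RtoC (/ kap * kap) * f' (z t))%C.
  - rewrite RtoC_mult. ring.
  - rewrite Rinv_l by lra. ring. }
(* At [t1] the difference of [G] and [kap] is purely imaginary, equal to [c] times [Ci], so [f'] is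
   within [Rabs c + 1 <= INR k] of [kap]. *)
assert (HW1 : Cmod (W t1) ^ S m * kap <= INR k).
{ rewrite HW. pose proof (Hfk t1 ltac:(lra)) as Q. apply Rabs_le_between in Q.
  pose proof (Hshift t1 ltac:(lra)) as Q2. rewrite E1 in Q2.
  replace (kap - kap) with 0 in Q2 by ring. rewrite Rabs_R0 in Q2. lra. }
assert (HWs : 2 ^ S m * INR k <= Cmod (W s) ^ S m * kap).
{ rewrite HW. pose proof (Hfk s ltac:(lra)) as Q. apply Rabs_le_between in Q.
  assert (S0 <= Cmod (G (z s) - RtoC kap)); [|lra].
  eapply Rle_trans; [|apply re_le_Cmod].
  replace (Re (G (z s) - RtoC kap)) with (- S0).
  - rewrite Rabs_Ropp. apply Rle_abs.
  - replace (Re (G (z s) - RtoC kap)) with (Re (G (z s)) - kap); [lra|].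
    destruct (G (z s)); unfold Re; simpl; ring. }
pose proof (Cmod_ge_0 (W t1)) as P1. pose proof (Cmod_ge_0 (W s)) as Ps.
assert (Hhalf : 2 * Cmod (W t1) <= Cmod (W s)).
{ apply (pow_le_inv _ _ (S m)); [exact Ps|lia|].
  rewrite Rpow_mult_distr. apply Rmult_le_reg_r with kap; [lra|].
  assert (0 < 2 ^ S m) by (apply pow_lt; lra). nra. }
set (Delta := Cmod (f (z t1) - f (z s))).
assert (HWD : Cmod (W s) <= 2 * (Delta / q)).
{ assert (Hd : Cmod (W s - W t1) = Delta / q).
  { unfold W, Delta.
    replace (1 - RtoC (/ q) * f (z s) - (1 - RtoC (/ q) * f (z t1)))%C with
      (RtoC (/ q) * (f (z t1) - f (z s)))%C by ring.
    rewrite Cmod_mult, Cmod_R, Rabs_pos_eq; [unfold Rdiv; ring|].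
    apply Rlt_le, Rinv_0_lt_compat; lra. }
  assert (Cmod (W s) <= Cmod (W t1) + Cmod (W s - W t1)); [|lra].
  replace (W s) with (W t1 + (W s - W t1))%C at 1 by ring. apply Cmod_triangle. }
assert (PDelta : 0 <= Delta) by apply Cmod_ge_0.
(* The factors [2 ^ S m] cancel and [kap = q / INR (S m)] removes one power of [q]; [1 <= INR k]
   finishes. *)
assert (Hlow : q ^ m <= Delta ^ S m).
{ assert (Q1 : Cmod (W s) ^ S m <= (2 * (Delta / q)) ^ S m) by (apply pow_incr; lra).
  unfold Rdiv in Q1. rewrite !Rpow_mult_distr, pow_inv in Q1.
  assert (Pq : 0 < q ^ m) by (apply pow_lt; lra).
  assert (P2 : 0 < 2 ^ S m) by (apply pow_lt; lra).
  assert (Q2 : INR k <= Delta ^ S m * / q ^ S m * kap).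
  { apply Rmult_le_reg_l with (2 ^ S m); [exact P2|]. nra. }
  assert (Q3 : Delta ^ S m * / q ^ S m * kap = Delta ^ S m / q ^ m / INR (S m)).
  { unfold kap. simpl (q ^ S m). field. repeat split; lra. }
  rewrite Q3 in Q2. apply Rle_div_r in Q2; [|lra].
  assert (Q4 : 1 <= Delta ^ S m / q ^ m) by nra.
  apply Rle_div_r in Q4; [|exact Pq]. lra. }
assert (Hup : Delta <= D * (INR k + S0)).
{ eapply Rle_trans.
  - apply (flow_displacement f d D s t1 Hf HD0); [lra|lra|].
    intros r Hr. apply HD.
    (* Before [t2] the distance from [f'] to [kap] is at most [3 * kap], hence
       [Cmod (W r) ^ S m <= 3]; this gives [Cmod (f (z r)) <= 4 * q], the range in which [D] bounds
       [d]. *)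
    assert (Hr3 : Cmod (W r) <= 3).
    { apply (pow_le_inv _ _ (S m)); [lra|lia|].
      apply Rle_trans with 3; [|pose proof (Rle_pow 3 1 (S m) ltac:(lra) ltac:(lia)); simpl in *; lra].
      apply Rmult_le_reg_r with kap; [lra|]. rewrite HW.
      pose proof (Hin r ltac:(lra)) as Q. simpl in Q.
      eapply Rle_trans; [apply Cmod_triangle|].
      rewrite Cmod_opp, Cmod_R, Rabs_pos_eq; lra. }
    replace (f (z r)) with (RtoC q * (1 - W r))%C.
    + rewrite Cmod_mult, Cmod_R, Rabs_pos_eq by lra.
      assert (Cmod (1 - W r) <= 4); [|nra].
      eapply Rle_trans; [apply Cmod_triangle|]. rewrite Cmod_opp, Cmod_1. lra.
    + unfold W. transitivity (RtoC (q * / q) * f (z r))%C.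
      * rewrite RtoC_mult. ring.
      * rewrite Rinv_r by lra. ring.
  - apply Rmult_le_compat_l; [exact HD0|]. rewrite E1, Es. lra. }
assert (Delta ^ S m <= (D * (INR k + S0)) ^ S m) by (apply pow_incr; lra).
lra.
Qed.

End GradientFlow.

(** * The limit function and its flow *)

(** The drift after stage [k] stays below 1, so the values never leave the disc of radius [rad + 1]
    of the current stage, and [step_close] keeps applying however large [w] is. *)
Lemma stage_limit_approx (s : nat -> stage) (G : C -> C) :
  (forall k, step k (s k) (s (S k))) -> fast_limit (fun k => fn (s k)) G ->
  forall k w, Cmod (fn (s k) w) <= rad (s k) -> Cmod (G w - fn (s k) w) <= 1.
Proof.
intros Hs HG k w Hw.
assert (Hrad : forall i, rad (s k) <= rad (s (k + i)%nat)).
{ induction i; [rewrite Nat.add_0_r; lra|].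
  rewrite Nat.add_succ_r. pose proof (step_rad _ _ _ (Hs (k + i)%nat)). lra. }
pose proof (half_pow_le_1 k) as Hpow.
assert (H : forall i, Cmod (fn (s (k + i)%nat) w - fn (s k) w) <= (1/2) ^ k - (1/2) ^ (k + i)).
{ induction i.
  - rewrite Nat.add_0_r. replace (fn (s k) w - fn (s k) w)%C with (RtoC 0) by ring.
    rewrite Cmod_0. lra.
  - rewrite Nat.add_succ_r. set (u := fn (s (k + i)%nat) w) in *.
    replace (fn (s (S (k + i))) w - fn (s k) w)%C with
      ((fn (s (S (k + i))) w - u) + (u - fn (s k) w))%C by ring.
    eapply Rle_trans; [apply Cmod_triangle|].
    assert (Hu : Cmod u <= rad (s (k + i)%nat) + 1).
    { replace u with (fn (s k) w + (u - fn (s k) w))%C by ring.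
      eapply Rle_trans; [apply Cmod_triangle|].
      specialize (Hrad i). pose proof (half_pow_pos (k + i)). lra. }
    pose proof (step_close _ _ _ (Hs (k + i)%nat) w (or_intror Hu)) as Q. fold u in Q.
    simpl in *. lra. }
destruct (nat_bound (Cmod w)) as [i Hi].
specialize (H i). pose proof (HG (k + i)%nat w (INR_le_trans _ i (k + i) Hi ltac:(lia))) as HGi.
simpl in HGi.
replace (G w - fn (s k) w)%C with ((G w - fn (s (k + i)%nat) w) + (fn (s (k + i)%nat) w - fn (s k) w))%C by ring.
eapply Rle_trans; [apply Cmod_triangle|]. lra.
Qed.

Lemma fast_limit_eventually_const (phi : nat -> C -> C) (l : C -> C) (w a : C) (k : nat) :
  fast_limit phi l -> (forall i, phi (k + i)%nat w = a) -> l w = a.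
Proof.
intros Hl Ha.
cut (Cmod (l w - a) = 0).
{ intros E. apply Cmod_eq_0 in E. replace (l w) with (l w - a + a)%C by ring.
  rewrite E. ring. }
apply Rle_antisym; [|apply Cmod_ge_0].
apply Rnot_lt_le. intros Hlt.
destruct (half_pow_small _ Hlt) as [N HN]. destruct (nat_bound (Cmod w)) as [N' HN'].
specialize (HN (k + (N + N'))%nat ltac:(lia)).
pose proof (Hl (k + (N + N'))%nat w (INR_le_trans _ N' (k + (N + N')) HN' ltac:(lia))) as Q.
rewrite Ha in Q. lra.
Qed.

Theorem theorem1p3 :
  exists g : C -> C, transcendental_entire g /\
    forall (a b : Rbar) (z : R -> C),
      trajectory g a b z -> ~ escapes_in_finite_time a b z.
Proof.
destruct stage_sequence as [s [Hadm Hstep]].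
set (phi := fun k => fn (s k)). set (phi1 := fun k => fn1 (s k)). set (phi2 := fun k => fn2 (s k)).
assert (C0 : fast_cauchy phi).
{ intros k w Hw. exact (step_close _ _ _ (Hstep k) w (or_introl Hw)). }
assert (C1 : fast_cauchy phi1).
{ intros k w Hw. exact (step_close1 _ _ _ (Hstep k) w Hw). }
assert (C2 : fast_cauchy phi2).
{ intros k w Hw. exact (step_close2 _ _ _ (Hstep k) w Hw). }
destruct (fast_cauchy_limit _ C0) as [G HG].
destruct (fast_cauchy_limit _ C1) as [g Hg].
destruct (fast_cauchy_limit _ C2) as [h Hh].
assert (DG : forall w, cderiv G w (g w)).
{ apply (fast_limit_derive phi phi1); try assumption.
  intros k w. apply (adm_deriv1 _ (Hadm k)). }
assert (Dg : forall w, cderiv g w (h w)).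
{ apply (fast_limit_derive phi1 phi2); try assumption.
  intros k w. apply (adm_deriv2 _ (Hadm k)). }
exists g. split; [split|].
- intros w. exists (h w). apply Dg.
- intros [n [p Hp]].
  (* Zeros of the stages persist and become arbitrarily large zeros of [g]; a polynomial [g] would
     vanish identically, but [g] is 1 at 0. *)
  assert (Z : g (RtoC 0) = RtoC 0).
  { rewrite Hp. apply poly_zeros_unbounded. intros k.
    destruct (step_new_zero _ _ _ (Hstep k)) as [w [Hw Ew]]. exists w. split; [exact Hw|].
    rewrite <- Hp. apply (fast_limit_eventually_const phi1 g w 0 (S k) Hg).
    intros i. unfold phi1. induction i; [rewrite Nat.add_0_r; exact Ew|].
    rewrite Nat.add_succ_r. apply (step_zeros _ _ _ (Hstep _)). exact IHi. }
  rewrite (fast_limit_eventually_const phi1 g (RtoC 0) 1 0 Hg) in Z.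
  + apply RtoC_inj in Z. lra.
  + intros i. apply (adm1_0 _ (Hadm i)).
- intros a b z [[Hab Hsol] _] [beta [-> Hlim]].
  assert (Ht0 : exists t0, Rbar_lt a (Finite t0) /\ t0 < beta).
  { destruct a as [a| |]; simpl in Hab.
    - exists ((a + beta) / 2). simpl. lra.
    - contradiction.
    - exists (beta - 1). simpl. split; [exact I|lra]. }
  destruct Ht0 as [t0 [Ha Hb]].
  (* One index bounds the starting value of [G], the remaining time, and the starting point, the
     latter so that stage [S k] is already close to [G] there. *)
  destruct (nat_bound (Cmod (G (z t0)) + 1 + (beta - t0) + Cmod (z t0))) as [k Hk].
  pose proof (Cmod_ge_0 (G (z t0))). pose proof (Cmod_ge_0 (z t0)).
  destruct (step_slow _ _ _ (Hstep k)) as [m [q Hslow]].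
  refine (no_fast_escape G g z t0 beta DG _ k m q _ _ _ _ Hslow
    (adm_deriv1 _ (Hadm k)) (adm_proper _ (Hadm (S k)))
    (stage_limit_approx s G Hstep HG (S k)) Hb Hlim _ _ _); try lra.
  + intros t Ht. apply Hsol; [|simpl; lra].
    destruct a as [a| |]; simpl in *; try contradiction; [lra|exact I].
  + pose proof (HG (S k) (z t0) (INR_le_trans (Cmod (z t0)) k (S k) ltac:(lra) ltac:(lia))) as Q.
    unfold phi in Q.
    pose proof (half_pow_le_1 (S k)).
    replace (fn (s (S k)) (z t0)) with (G (z t0) + - (G (z t0) - fn (s (S k)) (z t0)))%C by ring.
    eapply Rle_trans; [apply Cmod_triangle|]. rewrite Cmod_opp. lra.
Qed.
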